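(* Let $G=\mathbb{Z}_k\rtimes_n\mathbb{Z}_{ql}$, $c=\gcd(n-1,k)$ and $d=\sum_{h=0}^{q-1}n^h$. Let $i,j\in\mathbb{Z}$ with $j\not\equiv 0\bmod q$. Let $\chi$ be any irreducible character of $C_G(a^ib^j)$ (this centralizer is abelian and contains $Z(G)=\langle a^{k/c}\rangle\times\langle b^q\rangle\cong\mathbb{Z}_c\oplus\mathbb{Z}_l$). Let $\psi$ be a generator of $\widehat{\langle a^{k/c}\rangle}$ and $\phi$ a generator of $\widehat{\langle b^q\rangle}$, and let $r,s\in\mathbb{Z}$ be such that $\chi|_{Z(G)}=\psi^r\otimes\phi^s$. Let $V=M(\mathrm{class}(a^ib^j),\chi)$ be the corresponding irreducible $\mathcal{D}(G)$-module, and let $m\in\mathbb{N}$. With $h_G(m)$ and $\xi_{m,i}^r$ as defined in the context: (i) If $ql\nmid mj$, then $\nu_m(V)=0$. (ii) If $q\nmid l$ and $ql\mid mj$, then $$\nu_m(V)=\begin{cases}\frac{1}{cq}\left(k(q-2)+2\xi_{m,i}^r h_G(m)\right) & \text{if } kq\mid mdi,\ kq\mid mdr,\ l\mid ms,\\ \frac{2h_G(m)}{cq}\xi_{m,i}^r & \text{if } h_G(m)\mid mi,\ h_G(m)\mid mr,\ l\mid ms,\ (kq\nmid mdi \text{ or } kq\nmid mdr),\\ 0 & \text{otherwise.}\end{cases}$$ (iii) If $q\mid l$ and $ql\mid mj$, then $$\nu_m(V)=\begin{cases}\frac{1}{cq}\left(k(q-2)+2\xi_{m,i}^r h_G(m)\right)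 & \text{if } kq\mid mdi,\ kq\mid mdr,\ lq\mid ms,\\ \frac{2h_G(m)}{cq}\xi_{m,i}^r & \text{if } h_G(m)\mid mi,\ h_G(m)\mid mr,\ l\mid ms,\ (kq\nmid mdi \text{ or } kq\nmid mdr),\\ \frac{2}{cq}\left(\xi_{m,i}^r h_G(m)-k\right) & \text{if } kq\mid mdi,\ kq\mid mdr,\ l\mid ms,\ lq\nmid ms,\\ 0 & \text{otherwise.}\end{cases}$$
   Context: $\mathbb{N}=\{1,2,3,\dots\}$. Let $k,q,l,n\in\mathbb{N}$ with $q$ a prime dividing $|\mathrm{Aut}(\mathbb{Z}_k)|$, $n^q\equiv 1\bmod k$ and $n\not\equiv 1\bmod k$. Then $\mathbb{Z}_k\rtimes_n\mathbb{Z}_{ql}$ denotes the (non-abelian, order $kql$) group $\langle a,b\mid a^k=b^{ql}=1,\ bab^{-1}=a^n\rangle$. $\hat A$ denotes the group of linear characters of a finite abelian group $A$. If $q\mid m$ (which holds whenever $ql\mid mj$ and $q\nmid j$), put $h_G(m)=\gcd\left(\frac{m}{q}(d-q),k\right)$ and choose an integer $u$, a unit modulo $k$, with $u\frac{m}{q}(d-q)\equiv h_G(m)\bmod k$. If moreover $h_G(m)\mid mi$, put $v_i=\frac{mi}{h_G(m)}u\in\mathbb{Z}$ and $\xi_{m,i}^r=\psi\left(a^{rd\frac{m}{q}v_i}\right)$ (note $a^d\in\langle a^{k/c}\rangle$). For a finite group $G$, the Drinfel'd double $\mathcal{D}(G)$ is the complex Hopf algebra with basis $\{p_g\bowtie x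 : g,x\in G\}$, multiplication $(p_g\bowtie x)(p_h\bowtie y)=\delta_{g,xhx^{-1}}\,p_g\bowtie xy$, unit $\sum_g p_g\bowtie 1$, comultiplication $\Delta(p_g\bowtie x)=\sum_{uv=g}(p_u\bowtie x)\otimes(p_v\bowtie x)$ and counit $\epsilon(p_g\bowtie x)=\delta_{g,1}$. Its integral with counit value 1 is $\Lambda=\frac{1}{|G|}\sum_{x\in G}p_1\bowtie x$. Put $\Lambda^{[m]}=\sum\Lambda_1\Lambda_2\cdots\Lambda_m$ (the product of the $m$ tensor factors of the iterated comultiplication of $\Lambda$). For a finite-dimensional $\mathcal{D}(G)$-module $V$ with character $\chi_V$, the $m$-th indicator is $\nu_m(V)=\chi_V(\Lambda^{[m]})$. For $t\in G$ and an irreducible representation (or its character) $\rho$ of $C_G(t)$ on a space $W$, the irreducible module $M(\mathrm{class}(t),\rho)$ is defined as follows. Write $\mathrm{class}(t)=\{t_1,\dots,t_N\}$ for the conjugacy class and $t_i=g_itg_i^{-1}$. Then $M(\mathrm{class}(t),\rho)=\bigoplus_{i=1}^N g_i\otimes W$, with $p_h\bowtie 1$ acting by $g_i\otimes w\mapsto\delta_{h,t_i}\,g_i\otimes w$, and $x\in G$ acting by $g_i\otimes w\mapsto g_j\otimes\rho(\gamma)w$ where $xg_i=g_j\gamma$ with $\gamma\in C_G(t)$. *)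

(* Defs.v *)
From HB Require Import structures.
From mathcomp Require Export all_boot all_order all_algebra all_fingroup.
From mathcomp Require Export all_solvable all_character.

Set Implicit Arguments.
Unset Strict Implicit.
Unset Printing Implicit Defensive.

Import GRing.Theory.

Local Open Scope ring_scope.

(* Throughout, C : numClosedFieldType plays the role of the complex numbers   *)
(* (both algC and R[i], for R the real numbers, are instances), and a finite  *)
(* group G is the whole of a finGroupType.                                    *)

Section Groups.

Variable gT : finGroupType.

Definition expgz (x : gT) (z : int) : gT :=
  match z with
  | Posz e => (x ^+ e)%g
  | Negz e => (x ^- e.+1)%g
  end.

(* gT is < a, b | a ^ k = b ^ N = 1, b a b^-1 = a ^ n >, with a and b the     *)
(* given elements: two generators of the presented group that satisfy the     *)
(* relations are the images of the canonical ones under an automorphism.      *)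
Definition presented_semidirect (k N n : nat) (a b : gT) : Prop :=
  [/\ <<[set a; b]>>%g = [set: gT],
      (a ^+ k = 1)%g, (b ^+ N = 1)%g, (b * a * b^-1 = a ^+ n)%g &
      ([set: gT] \isog Grp (x : y : x ^+ k, y ^+ N, y * x * y^-1 = x ^+ n))%g].

End Groups.

Section LinearCharacters.

Variables (C : numClosedFieldType) (gT : finGroupType).

(* Only the values of xi on A matter. *)
Definition linear_char_on (A : {set gT}) (xi : gT -> C) : Prop :=
  xi 1%g = 1 /\ {in A &, forall x y, xi (x * y)%g = xi x * xi y}.

Definition generates_dual (A : {set gT}) (psi : gT -> C) : Prop :=
  linear_char_on A psi /\
  forall xi, linear_char_on A xi ->
    exists e : int, {in A, forall x, xi x = psi x ^ e}.

End LinearCharacters.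

Section DrinfeldDouble.

Variables (C : numClosedFieldType) (gT : finGroupType).

(* w : ddouble is \sum_(g, x) w (g, x) *: p_g |><| x. *)
Definition ddouble := {ffun gT * gT -> C^o}.

Definition dbasis (b : gT * gT) : ddouble := [ffun b' => (b' == b)%:R].

Definition dmul (v w : ddouble) : ddouble :=
  \sum_(b : gT * gT) \sum_(b' : gT * gT | b.1 == (b.2 * b'.1 * b.2^-1)%g)
    (v b * w b') *: dbasis (b.1, b.2 * b'.2)%g.

Definition dunit : ddouble := \sum_(g : gT) dbasis (g, 1%g).

(* The m-th tensor power of the double, with its basis of pure tensors. *)
Definition dtens (m : nat) := {ffun m.-tuple (gT * gT) -> C^o}.

Definition dtens_basis m (t : m.-tuple (gT * gT)) : dtens m :=
  [ffun t' => (t' == t)%:R].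

(* Delta \otimes id^{\otimes m}, where                                        *)
(* Delta (p_g |><| x) = \sum_(u v = g) (p_u |><| x) \otimes (p_v |><| x).     *)
Definition dcomul_first m (w : dtens m.+1) : dtens m.+2 :=
  \sum_(t : m.+1.-tuple (gT * gT)) w t *:
    (let: (g, x) := thead t in
     \sum_(uv : gT * gT | (uv.1 * uv.2)%g == g)
        dtens_basis [tuple of (uv.1, x) :: (uv.2, x) :: behead t]).

(* The iterated comultiplication, with m + 1 tensor factors. *)
Fixpoint dcomul_iter (m : nat) (w : ddouble) : dtens m.+1 :=
  match m with
  | 0 => \sum_(b : gT * gT) w b *: dtens_basis [tuple b]
  | m'.+1 => dcomul_first (dcomul_iter m' w)
  end.

Definition dtens_mul m (w : dtens m) : ddouble :=
  \sum_(t : m.-tuple (gT * gT)) w t *: \big[dmul/dunit]_(b <- t) dbasis b.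

(* w^[m] = w_1 w_2 ... w_m, for m > 0. *)
Definition sweedler_power (m : nat) (w : ddouble) : ddouble :=
  dtens_mul (dcomul_iter m.-1 w).

Definition dintegral : ddouble :=
  (#|[set: gT]|%:R^-1 : C) *: \sum_(x : gT) dbasis (1%g, x).

End DrinfeldDouble.

Section SimpleModule.

Variables (C : numClosedFieldType) (gT : finGroupType) (t : gT).

Definition class_type := {s : gT | s \in (t ^: [set: gT])%g}.

(* A choice of the g_i: t_i = g_i t g_i^-1 for each t_i in the class of t. *)
Definition class_reps (g : class_type -> gT) : Prop :=
  forall i, val i = (g i * t * (g i)^-1)%g.

Variables (g : class_type -> gT) (dW : nat).
Variable rho : mx_representation C 'C[t] dW.

(* The direct sum of the g_i \otimes W, with W the column vectors (so that    *)
(* rho acts on the left).                                                     *)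
Definition dmod := {ffun class_type -> 'cV[C]_dW}.

Definition dmod_tensor (i : class_type) (w : 'cV[C]_dW) : dmod :=
  [ffun j => if j == i then w else 0].

(* p_h |><| x = (p_h |><| 1) x acts on v = \sum_i g_i \otimes v_i: x sends    *)
(* g_i \otimes w to g_j \otimes rho gamma w for the unique j such that        *)
(* gamma = g_j^-1 x g_i is in C_G(t), and p_h |><| 1 keeps the summands with  *)
(* t_j = h.                                                                   *)
Definition dmod_act_basis (h x : gT) (v : dmod) : dmod :=
  \sum_i \sum_(j | ((g j)^-1 * x * g i \in 'C[t])%g && (val j == h))
    dmod_tensor j (rho ((g j)^-1 * x * g i)%g *m v i).

Definition dmod_act (w : ddouble C gT) (v : dmod) : dmod :=
  \sum_(b : gT * gT) w b *: dmod_act_basis b.1 b.2 v.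

(* The trace of the action, in the basis of the g_i \otimes e_a. *)
Definition dmod_char (w : ddouble C gT) : C :=
  \sum_i \sum_(a < dW) dmod_act w (dmod_tensor i (delta_mx a 0)) i a 0.

Definition indicator (m : nat) : C :=
  dmod_char (sweedler_power m (dintegral C gT)).

End SimpleModule.

(* Main.v *)
Require Import Defs.
From mathcomp Require Import separable cyclotomic zify ring.

(* Expanding the double, nu_m(V) is |C_G(t)|^-1 times the sum of              *)
(* chi(y^-m) over the solutions y of (t y)^m = y^m, where t = a^i b^j. Such a *)
(* y^m is central. The solutions are of three kinds, according to whether y,  *)
(* t y or neither of them lies in N = <a><b^q>, a subgroup of index q. For q  *)
(* not dividing f the q-th power of a^X b^f is a^(X d) b^(f q); so there are  *)
(* solutions of the third kind only if kq | m d i, and then all y outside N   *)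
(* and t^-1 N are solutions, over which the character sum is full or zero.    *)
(* The solutions in N form a coset of <a^(k/h)><b^q>, on which chi(y^-m)      *)
(* either is constant, equal to xi, or sums to zero. The map y |-> (y t)^-1   *)
(* exchanges the first two kinds and turns xi into its inverse, but xi^2 = 1: *)
(* every primary part of k divides 2 d or 2 (d - q).                          *)

(** In detail, write m = q m', D = m' d and E = m' (d - q), so that m = D - E and h = gcd(E, k).
    [indicatorE] turns nu_m(V) into the sum over the y with (t y)^m = y^m, and [card_cent_ab] gives
    |C_G(t)| = c q l. Elements have a unique normal form a^X b^f ([eq_ab]), so the equation splits
    into a congruence modulo q l, which amounts to ql | m j and yields case (i) by
    [twisted_eq_order], and a congruence modulo k. Translating by the central element b^q kills the
    sum unless l | m s ([twisted_sum_eq0]).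

    For y in N the congruence modulo k is i D + X E = 0, linear in X: it is solvable exactly when h
    | m i, and then its h l solutions y form a coset ([inner_coset]), contributing h l xi if h | m r
    and 0 otherwise. The y with t y in N contribute the same amount ([translate_sum], [xi_sqr]). The
    k l (q - 2) remaining y are all solutions or none, and their sum is full or zero ([outer_sum]).
    Dividing the total in [twisted_sum] by c q l leaves k (q - 2) and 2 xi h over c q. The condition
    for the first term implies that for the second, whence the case distinction. Finally ql | m j
    and l | m s force lq | m s ([dvdz_expn_phi]), so (ii) and (iii) take the same values. *)

Set Implicit Arguments.
Unset Strict Implicit.
Unset Printing Implicit Defensive.

Import GRing.Theory.

(** * The presented group and its arithmetic *)

Section PowerAut.
Variables k n N : nat.
Hypotheses (k_gt1 : (1 < k)%N) (nN1 : (n ^ N = 1 %[mod k])%N) (N_gt0 : (0 < N)%N).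
Local Open Scope group_scope.

Lemma coprime_expn_eq1 : coprime k n.
Proof.
have : coprime k (n ^ N) by rewrite coprime_sym -coprime_modl nN1 coprime_modl coprime1n.
by rewrite coprime_pexpr.
Qed.

Let z : 'Z_k := Zp1.

(** As n is a unit modulo k, taking n-th powers is an automorphism of Z_k. It is the input to
    [Extremal.Grp], which realizes the presentation by a semidirect product of order k N. *)
Lemma Zp_power_aut : exists s, [/\ s \in Aut <[z]>, #[s] %| N & s z = z ^+ n].
Proof.
have oz : #[z] = k by rewrite order_Zp1 Zp_cast.
have Un : (n%:R : 'Z_#[z])%R \is a GRing.unit by rewrite oz unitZpE // coprime_expn_eq1.
pose s := aut (injm_cyclem (FinRing.unit _ Un)) (im_cyclem (FinRing.unit _ Un)).
have sE x : x \in <[z]> -> s x = x ^+ n.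
  case/cycleP=> e ->; rewrite autE ?mem_cycle // /cyclem /= val_Zp_nat ?oz //.
  by apply/eqP; rewrite /cyclem -!expgM eq_expg_mod_order oz modnMmr.
exists s; split; [exact: Aut_aut | | by rewrite sE ?cycle_id].
have sX e x : x \in <[z]> -> (s ^+ e) x = x ^+ (n ^ e).
  elim: e x => [|e IHe] x zx; first by rewrite perm1.
  by rewrite expgSr permM IHe // sE ?groupX // -expgM expnSr.
rewrite order_dvdn; apply/eqP; have AsN : s ^+ N \in Aut <[z]> by apply/groupX/Aut_aut.
apply: (eq_Aut AsN (group1 _)) => x zx.
rewrite sX // perm1; case/cycleP: zx => e ->; rewrite -expgM.
by apply/eqP; rewrite eq_expg_mod_order oz -modnMmr nN1 modnMmr muln1.
Qed.
End PowerAut.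

Section Presented.
Variables (gT : finGroupType) (k N n : nat) (a b : gT).
Hypotheses (k_gt1 : (1 < k)%N) (N_gt1 : (1 < N)%N).
Hypotheses (nN1 : (n ^ N = 1 %[mod k])%N).
Hypothesis presG : presented_semidirect k N n a b.
Local Open Scope group_scope.

Let ak1 : a ^+ k = 1. Proof. by case: presG. Qed.
Let bN1 : b ^+ N = 1. Proof. by case: presG. Qed.
Let ba : b * a * b^-1 = a ^+ n. Proof. by case: presG. Qed.

Lemma norm_b_a : <[b]> \subset 'N(<[a]>).
Proof.
rewrite -cycleV cycle_subG; apply/normP/eqP.
rewrite eqEcard cardJg leqnn andbT -cycleJ cycle_subG.
by rewrite conjgE invgK mulgA ba mem_cycle.
Qed.

Lemma presented_gen : <[a]> * <[b]> = [set: gT].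
Proof.
case: presG => <- *; rewrite -norm_joinEr ?norm_b_a // joing_idl joing_idr.
by rewrite joingE.
Qed.

(** By the universal property of the presentation, the concrete semidirect product of order k N is a
    quotient of the group. *)
Lemma leq_card_presented : (k * N <= #|gT|)%N.
Proof.
have homE : [set: Extremal.gtype k N n] \homg [set: gT].
  case: presG => _ _ _ _ ->.
  have := isoGrp_hom (Extremal.Grp N_gt1 k_gt1 (Zp_power_aut k_gt1 nN1 (ltnW N_gt1))).
  case/existsP=> -[x y] /= /eqP[defG xk yN xy].
  (* [Extremal.Grp] has the relation y^-1 x y = x^n, so y is inverted to obtain y x y^-1 = x^n. *)
  apply/existsP; exists (x, y^-1); rewrite /= !xpair_eqE.
  by rewrite cycleV defG expgVn yN invgK xk -mulgA -conjgE xy invg1 !eqxx.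
have := leq_homg homE.
by rewrite Extremal.card // mulnC cardsT.
Qed.

(** The relations bound the orders of a and b from above, [leq_card_presented] bounds the group from
    below, and the product formula for <a><b> leaves no slack. *)
Lemma presented_orders : [/\ #[a] = k, #[b] = N, <[a]> :&: <[b]> = 1 & #|gT| = (k * N)%N].
Proof.
have le_a : (#[a] <= k)%N by rewrite dvdn_leq ?order_dvdn ?ak1 // ltnW.
have le_b : (#[b] <= N)%N by rewrite dvdn_leq ?order_dvdn ?bN1 // ltnW.
have := mul_cardG <[a]> <[b]>; rewrite presented_gen cardsT -!orderE => oab.
have := leq_card_presented => leG.
have leM := leq_mul le_a le_b.
have leGi : (#|gT| <= #|gT| * #|<[a]> :&: <[b]>|)%N by rewrite leq_pmulr ?cardG_gt0.
rewrite -oab in leGi.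
have [eM eG] : (#[a] * #[b] = k * N /\ #|gT| = k * N)%N by lia.
have := oab; rewrite eM eG -{1}[(k * N)%N]muln1.
have kN_gt0 : (0 < k * N)%N by rewrite muln_gt0 (ltnW k_gt1) (ltnW N_gt1).
move/eqP; rewrite eqn_pmul2l // => /eqP i1.
have ea : #[a] = k.
  apply/eqP; rewrite eqn_leq le_a leqNgt; apply/negP => lt_a.
  have : (#[a] * #[b] < k * N)%N; last by rewrite eM ltnn.
  by rewrite (leq_ltn_trans (leq_mul (leqnn _) le_b)) // ltn_pmul2r ?(ltnW N_gt1).
split=> //; first by move/eqP: eM; rewrite ea eqn_pmul2l ?(ltnW k_gt1) // => /eqP.
by apply/eqP; rewrite trivg_card1 -i1.
Qed.

End Presented.

(** * Divisibility of d and d - q by the primary parts of k *)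

Definition cyc_sum q n : nat := \sum_(0 <= h < q) n ^ h.

Section Arith.
Variables k q n : nat.
Hypotheses (k_gt1 : (1 < k)%N) (q_pr : prime q) (n_gt0 : (0 < n)%N).
Hypothesis (nq1 : (n ^ q = 1 %[mod k])%N).
Local Notation d := (cyc_sum q n).

(** Each n^h - 1 is n - 1 times a geometric sum. The cofactor is kept explicit because it is later
    reduced modulo q. *)
Lemma cyc_sum_sub :
  d = q + (n - 1) * \sum_(0 <= h < q) \sum_(0 <= g < h) n ^ g.
Proof.
have q_sum : q = \sum_(0 <= h < q) 1 by rewrite sum_nat_const_nat subn0 muln1.
rewrite big_distrr /= [X in _ = X + _]q_sum -big_split.
apply: eq_big_nat => h _ /=.
by rewrite big_mkord subn1 -predn_exp add1n prednK // expn_gt0 n_gt0.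
Qed.

Lemma dvdn_cyc_sum_pred : k %| d * (n - 1).
Proof.
rewrite mulnC subn1 /cyc_sum big_mkord -predn_exp -subn1.
by rewrite -eqn_mod_dvd ?expn_gt0 ?n_gt0 // nq1.
Qed.

Lemma leq_cyc_sum : q <= d.
Proof. by rewrite cyc_sum_sub leq_addr. Qed.

Lemma dvdn_cyc_sum_sub : k %| d * (d - q).
Proof. by rewrite {2}cyc_sum_sub addKn mulnA dvdn_mulr // dvdn_cyc_sum_pred. Qed.

(* A prime p <> q divides at most one of d and d - q, while for p = q odd,    *)
(* d = q modulo q^2, so that d (n - 1) = 0 forces q (n - 1) = 0 modulo k`_p.   *)
Lemma part_dvdn_cyc_sum p : p \in \pi(k) ->
  (k`_p %| 2 * d) || (k`_p %| 2 * (d - q)).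
Proof.
rewrite mem_primes => /and3P[p_pr _ pk].
have k_gt0 := ltnW k_gt1.
set P := k`_p.
have Pk : P %| k by apply: dvdn_part.
have Pnat : p.-nat P by apply: part_pnat.
have copP x : ~~ (p %| x) -> coprime P x.
  rewrite -prime_coprime // => px; apply: pnat_coprime Pnat _.
  by rewrite p'natE // -prime_coprime.
have Pdd : P %| d * (d - q) := dvdn_trans Pk dvdn_cyc_sum_sub.
have [epq | npq] := eqVneq p q; last first.
  have [pd | /copP cPd] := boolP (p %| d); last first.
    by move: Pdd; rewrite Gauss_dvdr // => Pd; rewrite orbC dvdn_mull.
  have npd : ~~ (p %| d - q).
    apply: contra npq => pdq; rewrite -dvdn_prime2 //.
    by rewrite -(dvdn_addr q pdq) subnK ?leq_cyc_sum.
  by move: Pdd; rewrite Gauss_dvdl ?copP // => Pd; rewrite dvdn_mull.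
have Pdn : P %| d * (n - 1) := dvdn_trans Pk dvdn_cyc_sum_pred.
(* Here q = p divides k, so n = n^q = 1 modulo q by Fermat. *)
have qn : q %| n - 1.
  rewrite -eqn_mod_dvd // -(fermat_little n q_pr); apply/eqP.
  have qk : q %| k by rewrite -epq.
  by rewrite -(modn_dvdm _ qk) nq1 (modn_dvdm _ qk).
(* For q = 2, d = n + 1 and d - q = n - 1 are consecutive even numbers whose product P divides; one
   of them is twice an odd number, so P divides twice the other. *)
have [q2 | q_neq2] := eqVneq q 2.
  have d2 : d = n + 1 by rewrite /cyc_sum q2 unlock /= expn0 expn1; lia.
  have dq2 : d - q = n - 1 by rewrite d2 q2 -[2]/(1 + 1) subnDr.
  rewrite dq2; rewrite d2 in Pdn *.
  have [w ew] := dvdnP qn; rewrite q2 in ew.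
  have [ow | ew2] := boolP (odd w).
    have : P %| w * (2 * (n + 1)) by move: Pdn; rewrite ew mulnC -mulnA.
    by rewrite Gauss_dvdr => [->//|]; rewrite copP // epq q2 dvdn2 ow.
  have En : n + 1 = w.+1 * 2 by rewrite mulSn -ew -[2]/(1 + 1) -addnA subnKC // addnC.
  have : P %| w.+1 * (2 * (n - 1)) by move: Pdn; rewrite En -mulnA.
  by rewrite Gauss_dvdr => [->|]; rewrite ?orbT // copP // epq q2 dvdn2 /= ew2.
apply/orP; right.
set T := \sum_(0 <= h < q) \sum_(0 <= g < h) n ^ g.
have dqT : d - q = (n - 1) * T by rewrite cyc_sum_sub addKn.
have n1 : n = 1 %[mod q] by apply/eqP; rewrite eqn_mod_dvd.
(* Modulo q every power of n is 1, so T is 0 + 1 + ... + (q - 1), the binomial coefficient of q over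
   2, which q divides as q is odd. *)
have qT : q %| T.
  have sum1 s : \sum_(0 <= g < s) n ^ g = s %[mod q].
    rewrite -modn_summ -[s in RHS]subn0 -[(s - 0)%N]muln1 -sum_nat_const_nat -[in RHS]modn_summ.
    by congr (_ %% _); apply: eq_bigr => g _; rewrite -modnXm n1 modnXm exp1n.
  rewrite /dvdn -modn_summ; under eq_bigr do rewrite sum1.
  rewrite modn_summ bin2_sum; apply: prime_dvd_bin => //=.
  by rewrite ltn_neqAle eq_sym q_neq2 prime_gt1.
have [T' eT] := dvdnP qT.
have dE : d = q * (1 + (n - 1) * T') by rewrite cyc_sum_sub -/T eT mulnDr muln1 mulnA [q * _]mulnC.
have copw : coprime P (1 + (n - 1) * T').
  by rewrite copP // epq dvdn_addl ?dvdn1 ?(dvdn_mulr _ qn) // (gtn_eqF (prime_gt1 q_pr)).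
move: Pdn; rewrite {1}dE mulnAC mulnC Gauss_dvdr // => Pqn.
by rewrite dqT eT dvdn_mull // [T' * q]mulnC mulnA dvdn_mulr // mulnC.
Qed.

Local Open Scope ring_scope.

(* This gives xi ^ 2 = 1. *)
Lemma dvdz_double_exponent (m' u i r : int) :
  let m := q%:Z * m' in
  let h := gcdz (m' * (d%:Z - q%:Z)) k in
  (h %| m * i)%Z -> (h %| m * r)%Z ->
  (k%:Z %| 2%:Z * ((m * i %/ h)%Z * u * (m' * d%:Z)) * r)%Z.
Proof.
move=> m h hmi hmr.
have sub_dq : d%:Z - q%:Z = (d - q)%N%:Z by rewrite subzn ?leq_cyc_sum.
set v := (_ %/ _)%Z; set e := _ * r.
have hv : v * h = m * i by rewrite /v divzK.
rewrite dvdzE; apply/dvdn_partP => [|p]; first exact: ltnW.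
set P := (k`_p)%N => pk.
have Pk : (P %| k)%N by apply: dvdn_part.
have /orP[Pd | Pdq] := part_dvdn_cyc_sum pk.
  have -> : e = (2 * d)%N%:Z * (v * u * m' * r) by rewrite /e PoszM; ring.
  by rewrite abszM dvdn_mulr.
(* By Bezout h is a combination of m' (d - q) and k, and P divides both 2 (d - q) and k. *)
have P2h : (P%:Z %| 2%:Z * h)%Z.
  have [x [y xy]] := Bezoutz (m' * (d%:Z - q%:Z)) k.
  have -> : 2%:Z * h = (2 * (d - q))%N%:Z * (x * m') + k%:Z * (2%:Z * y).
    by rewrite /h -xy PoszM -sub_dq; ring.
  by rewrite rpredD // dvdz_mulr.
have [R hR] := dvdzP hmr.
(* Split d as (d - q) + q; the part with q contains q m' r = m r = R h. *)
have -> : e = (2 * (d - q))%N%:Z * (v * u * m' * r) + 2%:Z * h * (R * v * u).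
  have -> : 2%:Z * h * (R * v * u) = 2%:Z * v * u * (R * h) by ring.
  by rewrite -hR /e /m PoszM -sub_dq; ring.
have : (P%:Z %| (2 * (d - q))%N%:Z * (v * u * m' * r) + 2%:Z * h * (R * v * u))%Z.
  by rewrite rpredD // dvdz_mulr.
by rewrite dvdzE.
Qed.

End Arith.

Local Open Scope ring_scope.

Lemma dvdz_subn (N s t : nat) :
  (N%:Z %| s%:Z - t%:Z)%Z = (s == t %[mod N])%N.
Proof. by rewrite -eqz_mod_dvd !modz_nat. Qed.

(** * Powers with integer exponents *)

Section IntPowers.
Variable gT : finGroupType.
Implicit Type x : gT.

Lemma expgz_mod x (N : nat) (z : int) :
  (0 < N)%N -> (x ^+ N = 1)%g -> expgz x z = (x ^+ `|(z %% N%:Z)%Z|)%g.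
Proof.
move=> N_gt0 xN1; have N0 : N%:Z != 0 by lia.
case: z => e; first by rewrite modz_nat /= expg_mod.
apply/eqP; rewrite /= eq_sym eq_mulVg1 -invMg -expgD.
rewrite invg_eq1 -order_dvdn (dvdn_trans (_ : _ %| N)%N) ?order_dvdn ?xN1 //.
have E := divz_eq (Negz e) N.
have := modz_ge0 (Negz e) N0; move: E; set r := (_ %% _)%Z; set p := (_ %/ _)%Z => E r0.
have : (N%:Z %| (`|r| + e.+1)%N%:Z)%Z.
  by apply/dvdzP; exists (- p); rewrite PoszD gez0_abs //; lia.
by rewrite dvdzE addnC.
Qed.

Lemma expgz_dvd x (z t : int) : (#[x]%g%:Z %| z - t)%Z -> expgz x z = expgz x t.
Proof.
rewrite -eqz_mod_dvd => /eqP e.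
by rewrite !(expgz_mod _ (order_gt0 x) (expg_order x)) e.
Qed.

Lemma expgz_eq1 x z : (expgz x z == 1%g) = (#[x]%g%:Z %| z)%Z.
Proof.
case: z => e /=; first by rewrite -order_dvdn.
by rewrite invg_eq1 -order_dvdn NegzE dvdzE abszN.
Qed.

Lemma expgzD x z t : expgz x (z + t) = (expgz x z * expgz x t)%g.
Proof.
have o0 := order_gt0 x.
rewrite !(expgz_mod _ o0 (expg_order x)) -expgD; apply/eqP.
rewrite eq_expg_mod_order -dvdz_subn PoszD !gez0_abs ?modz_ge0 //; try by lia.
by rewrite -eqz_mod_dvd modz_mod modzDm.
Qed.

Lemma expgzN x z : expgz x (- z) = ((expgz x z)^-1)%g.
Proof. by apply/eqP; rewrite eq_sym eq_invg_mul -expgzD subrr. Qed.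

Lemma expgzM x z (e : nat) : expgz x (z * e%:Z) = (expgz x z ^+ e)%g.
Proof.
elim: e => [|e IHe]; first by rewrite mulr0.
by rewrite expgSr -IHe -expgzD; congr expgz; lia.
Qed.

Lemma expgzMz x (z e : int) : expgz x (z * e) = expgz (expgz x z) e.
Proof.
case: e => e /=; first exact: expgzM.
by rewrite NegzE mulrN expgzN expgzM.
Qed.

Lemma mem_expgz x z : expgz x z \in <[x]>%g.
Proof. by case: z => e /=; rewrite ?groupV mem_cycle. Qed.

Lemma cycle_expgz x y : y \in <[x]>%g -> exists z, y = expgz x z.
Proof. by case/cycleP=> e ->; exists (Posz e). Qed.

End IntPowers.

(** * The indicator as a character sum *)

Section Double.

Variables (C : numClosedFieldType) (gT : finGroupType).
Implicit Types (u x y : gT) (w : ddouble C gT).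

Lemma dcomul_firstE m (w : dtens C gT m.+1) (t : m.+2.-tuple (gT * gT)) :
  dcomul_first w t =
  let b := thead t in let b' := thead [tuple of behead t] in
  (b.2 == b'.2)%:R *
    w [tuple of ((b.1 * b'.1)%g, b.2) :: behead (behead t)].
Proof.
case/tupleP: t => [[u x] t]; case/tupleP: t => [[v y] t].
rewrite /dcomul_first sum_ffunE /=.
(* Only the basis tensor obtained by merging the first two factors can produce the given one. *)
set t0 := [tuple of ((u * v)%g, x) :: _].
rewrite (bigD1 t0) //= [X in _ + X]big1 ?addr0 => [|s].
  rewrite !ffunE ?theadE sum_ffunE (bigD1 (u, v)) //= [X in _ + X]big1 ?addr0.
    rewrite ffunE mulrC -val_eqE /= !eqseq_cons !xpair_eqE !eqxx !andbT /=.
    by rewrite eq_sym.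
  case=> u' v' /andP[_]; rewrite xpair_eqE ffunE -val_eqE /= !eqseq_cons.
  by rewrite !xpair_eqE !(eq_sym u) !(eq_sym v); case: eqP; case: eqP; rewrite ?andbF.
case/tupleP: s => [[g z] s]; rewrite !ffunE ?theadE sum_ffunE => ne_s.
rewrite big1 ?[_ *: _]mulr0 // => -[u' v'] /= /eqP guv.
rewrite ffunE; case: eqP => //= /(congr1 val) /= [eu ex ev ey es].
case/eqP: ne_s; apply: val_inj => /=.
by rewrite -guv -eu -ex -ev es.
Qed.

Lemma dcomul_iterE m w (t : m.+1.-tuple (gT * gT)) :
  dcomul_iter m w t =
  (all (fun b => b.2 == (thead t).2) t)%:R *
    w ((\prod_(b <- t) b.1)%g, (thead t).2).
Proof.
elim: m t => [|m IHm] t.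
  case/tupleP: t => b t; rewrite tuple0 /= sum_ffunE (bigD1 b) //= [X in _ + X]big1.
    rewrite !ffunE (eqxx [tuple b]) /= (eqxx b.2) big_seq1 addr0.
    by rewrite mul1r [_ *: _]mulr1; case: b.
  move=> b' ne_b; rewrite !ffunE -val_eqE /= eqseq_cons andbT.
  by rewrite eq_sym (negPf ne_b) [_ *: _]mulr0.
rewrite [dcomul_iter _ _]/= dcomul_firstE; cbv zeta; rewrite IHm /=.
case/tupleP: t => b t; case/tupleP: t => b' t.
rewrite !theadE /= !big_cons mulgA mulrA -natrM mulnb !eqxx /= ?theadE.
by congr (_%:R * _); rewrite [b'.2 == _]eq_sym.
Qed.

Lemma dbasis_mul (b b' : gT * gT) :
  dmul (dbasis C b) (dbasis C b') =
  if b.1 == (b.2 * b'.1 * b.2^-1)%g then dbasis C (b.1, b.2 * b'.2)%g else 0.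
Proof.
rewrite /dmul (bigD1 b) //= [X in _ + X]big1 ?addr0 => [|b1 ne_b].
  rewrite big_mkcond (bigD1 b') //= [X in _ + X]big1 => [|b1 ne_b].
    by rewrite addr0 !ffunE !eqxx mulr1 scale1r.
  by rewrite !ffunE (negPf ne_b) mulr0 scale0r if_same.
by rewrite big1 // => b2 _; rewrite !ffunE (negPf ne_b) mul0r scale0r.
Qed.

Lemma dmul0r v : dmul v (0 : ddouble C gT) = 0.
Proof. by do 2!rewrite /dmul big1 // => *; rewrite ffunE mulr0 scale0r. Qed.

Lemma eq_conjg (x u v : gT) : (u == x * v * x^-1)%g = (v == u ^ x)%g.
Proof.
by apply/eqP/eqP=> ->; rewrite conjgE !mulgA ?mulgK ?mulgV ?mulVg mul1g ?mulgKV.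
Qed.

Lemma dbasis_mul1 (b : gT * gT) : dmul (dbasis C b) (dunit C gT) = dbasis C b.
Proof.
rewrite /dmul (bigD1 b) //= [X in _ + X]big1 ?addr0 => [|b1 ne_b].
  have dunitE b' : dunit C gT b' = (b'.2 == 1%g)%:R.
    rewrite sum_ffunE (bigD1 b'.1) //= [X in _ + X]big1 ?addr0 => [|g ne_g].
      by rewrite ffunE -pair_eqE /= eqxx.
    by rewrite ffunE -pair_eqE /= eq_sym (negPf ne_g).
  rewrite (bigD1 ((b.1 ^ b.2)%g, 1%g)) /=; last by rewrite conjgE !mulgA mulgK mulgV mul1g.
  rewrite [X in _ + X]big1 ?addr0.
    by rewrite dunitE ffunE !eqxx mulr1 scale1r mulg1; case: b.
  case=> u x; rewrite dunitE -pair_eqE /= => /andP[].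
  rewrite eq_conjg => -> /= /negPf->.
  by rewrite mulr0 scale0r.
by rewrite big1 // => b2 _; rewrite !ffunE (negPf ne_b) mul0r scale0r.
Qed.

(** Consecutive factors (p_v |><| x) (p_w |><| x) have a nonzero product only for w = v ^ x, so the
    indices must run along an orbit of conjugation by x. *)
Lemma big_dbasis x u (s : seq gT) :
  \big[@dmul C gT/dunit C gT]_(v <- u :: s) dbasis C (v, x) =
  if fpath (conjg^~ x) u s then dbasis C (u, x ^+ (size s).+1)%g else 0.
Proof.
elim: s u => [|v s IHs] u; first by rewrite big_cons big_nil dbasis_mul1 expg1.
rewrite big_cons IHs /= eq_sym -eq_conjg.
case: ifP => _; last by rewrite andbF dmul0r.
by rewrite andbT dbasis_mul /= [in RHS]expgS eq_sym.
Qed.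

(** The i-th factor is x^-i u x^i, so the powers of x telescope to one x^-1 between consecutive
    copies of u. *)
Lemma prod_traject_conjg x u m :
  (\prod_(v <- traject (conjg^~ x) u m) v = (u * x^-1) ^+ m * x ^+ m)%g.
Proof.
elim: m u => [|m IHm] u; first by rewrite big_nil !expg0 mulg1.
have -> : (\prod_(v <- traject (conjg^~ x) u m.+1) v =
           u * \prod_(v <- traject (conjg^~ x) (u ^ x) m) v)%g.
  by rewrite trajectS big_cons.
have expS (z : gT) : (z ^+ m.+1 = z * z ^+ m)%g by rewrite expgS.
rewrite !expS.
rewrite IHm; have -> : (u ^ x * x^-1 = (u * x^-1) ^ x)%g by rewrite !conjgE !mulgA mulgK mulgKV.
by rewrite -conjXg conjgE !mulgA.
Qed.

Lemma dintegralE (b : gT * gT) :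
  dintegral C gT b = #|[set: gT]|%:R^-1 * (b.1 == 1%g)%:R.
Proof.
rewrite ffunE sum_ffunE (bigD1 b.2) //= [X in _ + X]big1 ?addr0 => [|x ne_x].
  by rewrite ffunE -pair_eqE /= eqxx andbT.
by rewrite ffunE -pair_eqE /= [b.2 == x]eq_sym (negPf ne_x) andbF.
Qed.

Lemma sweedler_power_dintegral m : (0 < m)%N ->
  sweedler_power m (dintegral C gT) =
  (#|[set: gT]|%:R^-1 : C) *: \sum_(x : gT)
    \sum_(u : gT | ((u * x^-1) ^+ m * x ^+ m == 1)%g) dbasis C (u, x ^+ m)%g.
Proof.
case: m => // m _; rewrite /sweedler_power /dtens_mul [m.+1.-1]/=.
have size_T (b : gT * gT) :
    size [seq (v, b.2) | v <- traject (conjg^~ b.2) b.1 m.+1] == m.+1.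
  by rewrite size_map size_traject.
(* For b = (u, x), this is the only tensor with first factor b whose factors have a nonzero product,
   by [big_dbasis]. *)
pose T b := Tuple (size_T b).
have Tfst b : (thead (T b)) = b by rewrite /thead (tnth_nth b) /=; case: b.
rewrite (partition_big (@thead m _) xpredT) //.
rewrite [in RHS](exchange_big_dep xpredT) // [in RHS]pair_big_dep.
rewrite scaler_sumr [RHS]big_mkcond; apply: eq_bigr => b _.
rewrite (bigD1 (T b)) /= ?Tfst // [X in _ + X]big1 ?addr0.
  rewrite dcomul_iterE dintegralE Tfst.
  have -> : (all (fun b0 => b0.2 == b.2) (T b)) = true.
    by apply/allP=> _ /mapP[v _ ->].
  have -> : (\prod_(b0 <- T b) b0.1 = (b.1 * b.2^-1) ^+ m.+1 * b.2 ^+ m.+1)%g.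
    by rewrite big_map prod_traject_conjg.
  rewrite mul1r -[_ :: _]/[seq (v, b.2) | v <- b.1 :: traject _ (b.1 ^ b.2)%g m].
  rewrite big_map big_dbasis (fpath_traject (conjg^~ b.2)) size_traject /=.
  by case: eqP; rewrite ?mulr1 // mulr0 scale0r.
move=> t /andP[/eqP tb neT].
rewrite dcomul_iterE tb; case: allP => [/allP eq2 | _]; last first.
  by rewrite mul0r scale0r.
have def_t : val t = [seq (v, b.2) | v <- b.1 :: [seq v.1 | v <- behead t]].
  case/tupleP: t tb eq2 {neT} => b0 t; rewrite theadE /= => -> /andP[_ eq2].
  congr (_ :: _); first by case: (b).
  rewrite -map_comp map_id_in // => v /(allP eq2) /eqP /= <-.
  by case: v.
rewrite def_t !big_map (big_dbasis b.2 b.1); case: ifP => [/fpathP[p]|_]; last exact: scaler0.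
move=> def_p; case/eqP: neT; apply: val_inj; rewrite def_t def_p.
have := size_tuple t; rewrite def_t size_map /= def_p size_traject => -[<-].
by [].
Qed.
End Double.

Section Indicator.

Variables (C : numClosedFieldType) (gT : finGroupType) (t : gT).
Variables (g : class_type t -> gT) (dW : nat).
Variable rho : mx_representation C 'C[t] dW.

Lemma dmod_charE (w : ddouble C gT) :
  dmod_char g rho w =
  \sum_b w b * \sum_(i | ((g i)^-1 * b.2 * g i \in 'C[t])%g && (val i == b.1))
    \tr (rho ((g i)^-1 * b.2 * g i)%g).
Proof.
rewrite /dmod_char /dmod_act.
under eq_bigr do under eq_bigr do rewrite sum_ffunE summxE.
under eq_bigr do rewrite exchange_big /=.
rewrite exchange_big /=; apply: eq_bigr => b _.
rewrite [in RHS]big_mkcond mulr_sumr; apply: eq_bigr => i _.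
rewrite -[RHS]/(w b * (if _ then _ else _)).
transitivity (\sum_(c < dW) w b *
  (if ((g i)^-1 * b.2 * g i \in 'C[t])%g && (val i == b.1)
   then rho ((g i)^-1 * b.2 * g i)%g c c else 0)).
  apply: eq_bigr => c _; rewrite ffunE mxE; congr (_ * _).
  rewrite sum_ffunE summxE (bigD1 i) //= [X in _ + X]big1 ?addr0 => [|j ne_j].
    rewrite sum_ffunE summxE big_mkcond (bigD1 i) //= [X in _ + X]big1 => [|j ne_j].
      rewrite addr0; case: ifP => // _; rewrite !ffunE !eqxx -colE mxE.
      by [].
    by case: ifP => // _; rewrite ffunE eq_sym (negPf ne_j) mxE.
  rewrite sum_ffunE summxE big1 // => l _; rewrite ffunE; case: ifP; last by rewrite mxE.
  by rewrite !ffunE (negPf ne_j) mulmx0 mxE.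
rewrite -mulr_sumr; case: ifP => //= _.
by rewrite big1.
Qed.

Hypothesis g_reps : class_reps g.

(** Conjugating x by g_i makes all the summands over the class equal, and the class size divided by
    |G| is 1/|C_G(t)|. The substitution x := x^-1 gives the final form. *)
Lemma indicatorE m : (0 < m)%N ->
  indicator g rho m = #|'C[t]%g|%:R^-1 *
    \sum_(x | ((t * x) ^+ m == x ^+ m)%g) \tr (rho (x ^- m)%g).
Proof.
move=> m_gt0; rewrite /indicator dmod_charE sweedler_power_dintegral //.
pose F (u y : gT) := \sum_(i | ((g i)^-1 * y * g i \in 'C[t])%g && (val i == u))
    \tr (rho ((g i)^-1 * y * g i)%g).
transitivity ((#|[set: gT]|%:R^-1 : C) * \sum_x
   \sum_(u | ((u * x^-1) ^+ m * x ^+ m == 1)%g) F u (x ^+ m)%g).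
  under eq_bigr => b _ do rewrite ffunE -mulrA.
  rewrite -mulr_sumr; congr (_ * _).
  under eq_bigr => b _ do rewrite sum_ffunE mulr_suml.
  rewrite exchange_big; apply: eq_bigr => x _ /=.
  under eq_bigr => b _ do rewrite sum_ffunE mulr_suml.
  rewrite exchange_big; apply: eq_bigr => u _ /=.
  rewrite (bigD1 (u, (x ^+ m)%g)) //= [X in _ + X]big1 ?addr0.
    by rewrite ffunE eqxx mul1r.
  by move=> b ne_b; rewrite ffunE (negPf ne_b) mul0r.
transitivity ((#|[set: gT]|%:R^-1 : C) * \sum_(i : class_type t)
   \sum_(x | ((t * x^-1) ^+ m * x ^+ m == 1)%g) \tr (rho (x ^+ m)%g)).
  congr (_ * _).
  transitivity (\sum_x \sum_(i : class_type t)
    if ((val i * x^-1) ^+ m * x ^+ m == 1)%g &&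
       ((g i)^-1 * x ^+ m * g i \in 'C[t])%g
    then \tr (rho ((g i)^-1 * x ^+ m * g i)%g) else 0).
    apply: eq_bigr => x _; rewrite /F (exchange_big_dep xpredT) //=.
    apply: eq_bigr => i _; rewrite big_mkcond (bigD1 (val i)) //= [X in _ + X]big1 ?addr0.
      by rewrite eqxx andbT.
    by move=> u ne_u; rewrite [val i == u]eq_sym (negPf ne_u) !andbF.
  rewrite exchange_big /=; apply: eq_bigr => i _.
  rewrite [RHS]big_mkcond (reindex_inj (conjg_inj (g i)^-1%g)) /=.
  apply: eq_bigr => x _.
  have -> : (val i = t ^ (g i)^-1)%g by rewrite g_reps conjgE invgK mulgA.
  rewrite -conjVg -conjMg -!conjXg -conjMg conjg_eq1.
  rewrite -[(_^-1 * _ * _)%g]mulgA -conjgE conjgKV.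
  case: eqP => //= txm; case: ifP => // /idP[].
  (* Membership of x^m in C_G(t) is automatic: x^m is also a power of t x^-1, so it commutes with x
     and t x^-1, hence with t. *)
  have xx: commute x (x ^+ m) by apply: commuteX.
  have def_xm : ((t * x^-1) ^- m = x ^+ m)%g by apply/eqP; rewrite eq_invg_mul txm.
  have: commute (x ^+ m)%g (t * x^-1 * x)%g.
    apply: commuteM; last exact: commute_sym.
    by rewrite -def_xm; apply/commute_sym/commuteV/commuteX.
  by rewrite mulgKV => tx; apply/cent1P.
rewrite big_const iter_addr_0 (card_sig (mem (t ^: [set: gT])%g)).
rewrite -index_cent1 setTI (reindex_inj invg_inj) /=.
rewrite -[X in _ * X]mulr_natl mulrA -{1}(Lagrange (subsetT 'C[t]%g)) natrM.
rewrite invfM -[X in X * _]mulrA mulVf ?mulr1; last first.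
  by rewrite Num.Theory.pnatr_eq0 -lt0n indexg_gt0.
congr (_ * _); apply: eq_big => x.
  by rewrite invgK expgVn -eq_mulgV1.
by rewrite expgVn.
Qed.
End Indicator.

(** * Linear characters of cyclic groups *)

Section FaithfulDual.
Variables (C : numClosedFieldType) (gT : finGroupType).

Lemma closed_prim_root N : (0 < N)%N -> exists w : C, N.-primitive_root w.
Proof.
pose p : {poly C} := 'X^N - 1 => N_gt0.
have [rs Dp] := closed_field_poly_normal p.
rewrite (monicP _) ?monicXnsubC // scale1r in Dp.
have rn1 : all N.-unity_root rs by apply/allP=> z; rewrite -root_prod_XsubC -Dp.
have sz_rs : (N < (size rs).+1)%N by rewrite -(size_prod_XsubC rs id) -Dp size_XnsubC.
have [|w] := hasP (has_prim_root N_gt0 rn1 _ sz_rs); last by exists w.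
by rewrite -separable_prod_XsubC -Dp separable_Xn_sub_1 // Num.Theory.pnatr_eq0 -lt0n.
Qed.

Lemma faithful_linear_char (x : gT) :
  exists xi : gT -> C, linear_char_on <[x]>%g xi /\
    {in <[x]>%g, forall y, xi y = 1 -> y = 1%g}.
Proof.
have [w w_prim] := closed_prim_root (order_gt0 x).
pose xi y := if [pick e : 'I_#[x]%g | y == x ^+ e]%g is Some e then w ^+ e else 1.
have xiX e : xi (x ^+ e)%g = w ^+ e.
  rewrite /xi; case: pickP => [f /eqP /esym/eqP | /(_ (Ordinal (ltn_pmod e (order_gt0 x))))].
    by rewrite eq_expg_mod_order -(eq_prim_root_expr w_prim) => /eqP.
  by rewrite /= expg_mod_order eqxx.
exists xi; split; first split.
- by rewrite -(expg0 x) xiX.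
- by move=> _ _ /cycleP[e ->] /cycleP[f ->]; rewrite -expgD !xiX exprD.
move=> _ /cycleP[e ->]; rewrite xiX => /eqP.
by rewrite -(prim_order_dvd w_prim) order_dvdn => /eqP.
Qed.

(** A cyclic group has a faithful linear character, which is a power of the generator [psi]; hence
    [psi] is faithful. This turns character values 1 into divisibilities. *)
Lemma generates_dual_eq1 (x : gT) (psi : gT -> C) :
  generates_dual <[x]>%g psi -> {in <[x]>%g, forall y, psi y = 1 -> y = 1%g}.
Proof.
move=> [_ gen] y xy psi1; have [xi [xi_lin xi_faithful]] := faithful_linear_char x.
have [e eqe] := gen xi xi_lin; apply: xi_faithful => //.
by rewrite eqe // psi1 exp1rz.
Qed.

Variables (A : {group gT}) (psi : gT -> C).
Hypothesis psi_lin : linear_char_on A psi.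

Lemma linear_char_neq0 x : x \in A -> psi x != 0.
Proof.
case: psi_lin => psi1 psiM Ax; apply: contra_eq_neq psi1 => psix0.
by rewrite -(mulgV x) psiM ?groupV // psix0 mul0r eq_sym oner_eq0.
Qed.

Lemma linear_char_expgz x e : x \in A -> psi (expgz x e) = psi x ^ e.
Proof.
case: psi_lin => psi1 psiM Ax.
have psiX f : psi (x ^+ f)%g = psi x ^+ f.
  elim: f => [|f IHf]; first by rewrite expg0.
  by rewrite expgS psiM ?groupX // IHf exprS.
case: e => f /=; first exact: psiX.
apply: (mulfI (linear_char_neq0 (groupX f.+1 Ax))).
rewrite -psiM ?groupV ?groupX // mulgV psi1 psiX NegzE -exprnN mulfV //.
by rewrite expf_neq0 // linear_char_neq0.
Qed.

End FaithfulDual.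

(** Translation by x multiplies the sum by z while preserving it. All cancellations in nonempty
    character sums below come from this. *)
Lemma sum_shift_eq0 (R : idomainType) (gT : finGroupType) (P : pred gT) (F : gT -> R)
    (x : gT) (z : R) :
  (forall y, P (x * y)%g = P y) -> (forall y, P y -> F (x * y)%g = z * F y) ->
  z != 1 -> \sum_(y | P y) F y = 0.
Proof.
move=> PM FM z1; set S := \sum_(y | _) _.
have : S = z * S.
  rewrite {1}/S (reindex_inj (mulgI x)) mulr_sumr.
  by apply: eq_big => [y|y]; [exact: PM | rewrite PM; exact: FM].
move/eqP; rewrite -subr_eq0 -{1}[S]mul1r -mulrBl mulf_eq0 subr_eq0 eq_sym (negPf z1).
by move/eqP.
Qed.

(** * The character sum in the semidirect product *)

Section Semidirect.
Variables (gT : finGroupType) (k q l n : nat) (a b : gT).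
Hypotheses (k_gt1 : (1 < k)%N) (q_pr : prime q) (l_gt0 : (0 < l)%N).
Hypotheses (nq1 : (n ^ q = 1 %[mod k])%N) (n_gt0 : (0 < n)%N).
Hypothesis presG : presented_semidirect k (q * l) n a b.

Local Notation A := (expgz a).
Let q_gt1 : (1 < q)%N. Proof. exact: prime_gt1. Qed.
Let q_gt0 : (0 < q)%N. Proof. exact: prime_gt0. Qed.
Let k_gt0 : (0 < k)%N. Proof. exact: ltnW. Qed.

Lemma expn_mod_order f : (q %| f)%N -> (n ^ f = 1 %[mod k])%N.
Proof. by case/dvdnP=> e ->; rewrite mulnC expnM -modnXm nq1 modnXm exp1n. Qed.

Lemma orders_semidirect :
  [/\ #[a]%g = k, #[b]%g = (q * l)%N, (<[a]> :&: <[b]> = 1)%g & #|gT| = (k * (q * l))%N].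
Proof.
apply: (presented_orders k_gt1 _ _ presG); first by rewrite (leq_trans q_gt1) // leq_pmulr.
by apply: expn_mod_order; rewrite dvdn_mulr.
Qed.

Let oa : #[a]%g = k. Proof. by case: orders_semidirect. Qed.
Let ob : #[b]%g = (q * l)%N. Proof. by case: orders_semidirect. Qed.

Lemma expgz_a_eq X Y : (k%:Z %| X - Y)%Z -> A X = A Y.
Proof. by rewrite -oa => /expgz_dvd. Qed.

Lemma expgz_a_natmod X s t : (s = t %[mod k])%N -> A (X * s%:Z) = A (X * t%:Z).
Proof.
move=> /eqP; rewrite -dvdz_subn => kst; apply: expgz_a_eq.
by rewrite -mulrBr dvdz_mull.
Qed.

Lemma conj_b_a f X : (b ^+ f * A X = A (X * (n ^ f)%:Z) * b ^+ f)%g.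
Proof.
have b1 Y : (b * A Y = A (Y * n%:Z) * b)%g.
  have ba : (a ^ b^-1 = a ^+ n)%g by case: presG => _ _ _ <- _; rewrite conjgE invgK mulgA.
  have -> : A (Y * n) = (A Y ^ b^-1)%g; last by rewrite conjgE invgK mulgA mulgKV.
  rewrite !(expgz_mod _ k_gt0 (_ : a ^+ k = 1)%g) -?oa ?expg_order // oa conjXg ba -expgM.
  apply/eqP; rewrite eq_expg_mod_order oa -dvdz_subn PoszM.
  by rewrite !gez0_abs ?modz_ge0 -?eqz_mod_dvd ?modz_mod; try lia; rewrite mulrC modzMmr.
elim: f X => [|f IHf] X; first by rewrite expg0 mulg1 mul1g expn0 mulr1.
rewrite expgSr -mulgA b1 mulgA IHf -mulgA; congr (A _ * _)%g.
by rewrite expnS PoszM; ring.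
Qed.

Lemma mul_ab X f Y g :
  (A X * b ^+ f * (A Y * b ^+ g) = A (X + Y * (n ^ f)%:Z)%R * b ^+ (f + g))%g.
Proof. by rewrite expgD expgzD -!mulgA [(b ^+ f * _)%g]mulgA conj_b_a !mulgA. Qed.

Lemma ab_repr y : exists X f, y = (A X * b ^+ f)%g.
Proof.
have: y \in (<[a]> * <[b]>)%g by rewrite (presented_gen presG) inE.
by case/mulsgP=> _ _ /cycle_expgz[X ->] /cycleP[f ->] ->; exists X, f.
Qed.

(** Uniqueness of the normal form, from the trivial intersection of <a> and <b>; it turns group
    equations into congruences. *)
Lemma eq_ab X f Y g :
  ((A X * b ^+ f == A Y * b ^+ g) = (k%:Z %| X - Y)%Z && (f == g %[mod q * l])%N)%g.
Proof.
apply/eqP/andP=> [e|[/expgz_a_eq-> /eqP e]]; last first.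
  by congr (_ * _)%g; apply/eqP; rewrite eq_expg_mod_order ob e.
have e1 : A (X - Y)%R = (b ^+ g * b ^- f)%g.
  rewrite addrC expgzD expgzN; apply: (mulgI (A Y)); apply: (mulIg (b ^+ f)%g).
  by rewrite mulKVg e !mulgA mulgKV.
have A1 : A (X - Y)%R = 1%g.
  have : A (X - Y)%R \in (<[a]> :&: <[b]>)%g.
    by rewrite inE mem_expgz e1 groupM ?groupV ?mem_cycle.
  by case: orders_semidirect => _ _ -> _ /set1P.
split; first by rewrite -oa -expgz_eq1 A1.
by rewrite -ob -eq_expg_mod_order eq_mulgV1 -eq_invg1 invMg invgK -e1 A1.
Qed.

Lemma pow_ab X f s :
  ((A X * b ^+ f) ^+ s = A (X * (\sum_(0 <= h < s) n ^ (f * h))%N%:Z)%R * b ^+ (f * s))%g.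
Proof.
elim: s => [|s IHs]; first by rewrite big_geq // mulr0 muln0 mul1g.
rewrite expgSr IHs mul_ab big_nat_recr //= mulnS [(f + _)%N]addnC; congr (A _ * _)%g.
by rewrite PoszD; ring.
Qed.

Lemma sum_expn_dvd f s : (q %| f)%N ->
  ((\sum_(0 <= h < s) n ^ (f * h)) = s %[mod k])%N.
Proof.
move=> qf; elim: s => [|s IHs]; first by rewrite big_geq.
by rewrite big_nat_recr //= -modnDm IHs expn_mod_order ?modnDm ?addn1 // dvdn_mulr.
Qed.

Local Notation d := (cyc_sum q n).

(** Multiplication by n rotates the terms of d modulo k, since n^q = 1; so a^(X d) commutes with
    b. *)
Lemma cyc_sum_shift X f : A (X * d%:Z * (n ^ f)%:Z) = A (X * d%:Z).
Proof.
rewrite -mulrA -PoszM; apply: expgz_a_natmod.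
elim: f => [|f IHf]; first by rewrite expn0 muln1.
rewrite expnS mulnCA -modnMmr IHf modnMmr.
apply/eqP; rewrite -(eqn_modDr 1); apply/eqP.
have -> : (n * d + 1 = d + n ^ q)%N.
  rewrite addnC /cyc_sum -big_nat_recr //= big_nat_recl //= expn0; congr (_ + _)%N.
  by rewrite big_distrr; apply: eq_bigr => h _; rewrite expnS.
by rewrite -modnDmr nq1 modnDmr.
Qed.

(** The map h |-> f h permutes the residues modulo q, and n^h depends only on h modulo q. *)
Lemma sum_expn_ndvd f : ~~ (q %| f)%N ->
  ((\sum_(0 <= h < q) n ^ (f * h)) = d %[mod k])%N.
Proof.
move=> qf; have cqf : coprime q f by rewrite prime_coprime.
rewrite /cyc_sum !big_mkord.
pose F (h : 'I_q) : 'I_q := Ordinal (ltn_pmod (f * h) q_gt0).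
have injF : injective F.
  move=> h h' /(congr1 val) /= e; apply: val_inj.
  have /eqP : (f * h = f * h' %[mod q])%N by [].
  rewrite -dvdz_subn !PoszM -mulrBr Gauss_dvdzr //.
  by rewrite dvdz_subn !modn_small // => /eqP.
rewrite [in RHS](reindex_inj injF) -modn_summ -[in RHS]modn_summ.
congr (_ %% k)%N; apply: eq_bigr => h _ /=.
rewrite {1}(divn_eq (f * h) q) expnD -modnMml expn_mod_order ?dvdn_mull //.
by rewrite modnMml mul1n.
Qed.

Lemma pow_ab_dvd X f s : (q %| f)%N ->
  ((A X * b ^+ f) ^+ s = A (X * s%:Z)%R * b ^+ (f * s))%g.
Proof. by move=> qf; rewrite pow_ab (expgz_a_natmod _ (sum_expn_dvd _ qf)). Qed.

Lemma pow_ab_ndvd X f s : ~~ (q %| f)%N ->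
  ((A X * b ^+ f) ^+ (q * s) = A (X * d%:Z * s%:Z)%R * b ^+ (f * (q * s)))%g.
Proof.
move=> qf; rewrite expgM pow_ab (expgz_a_natmod _ (sum_expn_ndvd qf)).
by rewrite pow_ab_dvd ?dvdn_mull // mulnA.
Qed.

Lemma bq_central y : commute y (b ^+ q)%g.
Proof.
have [X [f ->]] := ab_repr y; apply/commute_sym/commuteM; last exact: commuteX2.
rewrite /commute conj_b_a; congr (_ * _)%g.
by rewrite (expgz_a_natmod _ nq1) mulr1.
Qed.

(** K = 1 gives N, K = k/c the centre, and K = k/h the subgroup of which the solutions in N form a
    coset. *)
Definition ab_sub K := (<[a ^+ K]> <*> <[b ^+ q]>)%G.

Lemma ab_subE K : ab_sub K = (<[a ^+ K]> * <[b ^+ q]>)%g :> {set gT}.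
Proof.
rewrite /= cent_joinEr // cycle_subG; apply/centP => y _.
exact/commute_sym/bq_central.
Qed.

Lemma mem_ab_sub K X f : (K %| k)%N ->
  ((A X * b ^+ f)%g \in ab_sub K) = (K%:Z %| X)%Z && (q %| f)%N.
Proof.
move=> /dvdnP[e ek].
transitivity ((A X * b ^+ f)%g \in (<[a ^+ K]> * <[b ^+ q]>)%g); first by rewrite -ab_subE.
apply/mulsgP/andP => [[_ _ /cycleP[Y ->] /cycleP[g ->] /eqP] | [/dvdzP[Y ->] /dvdnP[g ->]]].
  rewrite -!expgM -[(a ^+ _)%g]/(A (K * Y)%N%:Z) eq_ab => /andP[kXY /eqP fg]; split.
    rewrite -[X](subrK (K * Y)%N%:Z) rpredD ?PoszM ?dvdz_mulr //.
    by rewrite (dvdz_trans _ kXY) // ek PoszM dvdz_mull.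
  rewrite /dvdn -(modn_dvdm f (dvdn_mulr l (dvdnn q))) fg modn_dvdm ?dvdn_mulr //.
  by rewrite modnMr.
exists (expgz (a ^+ K)%g Y) (b ^+ q ^+ g)%g; rewrite ?mem_expgz ?mem_cycle //.
rewrite -expgM mulnC; congr (_ * _)%g.
have ak : (a ^+ K ^+ k = 1)%g by rewrite -expgM mulnC expgM -oa expg_order expg1n.
rewrite (expgz_mod _ k_gt0 ak) -expgM -[(a ^+ _)%g]/(A (K * _)%N%:Z).
apply: expgz_a_eq; rewrite PoszM gez0_abs ?modz_ge0 //; last by lia.
by rewrite mulrC -mulrBr dvdz_mull // -eqz_mod_dvd modz_mod.
Qed.

Lemma card_ab_sub K : (K %| k)%N -> #|ab_sub K| = (k %/ K * l)%N.
Proof.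
move=> Kk; rewrite ab_subE TI_cardMg.
  rewrite -!orderE !orderXdiv ?oa ?ob ?dvdn_mulr //.
  by rewrite mulKn.
apply/trivgP; case: orders_semidirect => _ _ <- _.
by rewrite setISS // cycle_subG mem_cycle.
Qed.

Lemma inv_mod_q J : ~~ (q %| J)%N -> exists s, (J * s = 1 %[mod q])%N.
Proof.
move=> qJ; have J_gt0 : (0 < J)%N by case: J qJ => //; rewrite dvdn0.
have /(coprimeP _ J_gt0)[[u v] /= e] : coprime J q by rewrite coprime_sym prime_coprime.
exists u; have -> : (J * u = 1 + v * q)%N by rewrite mulnC; lia.
by rewrite addnC modnMDl.
Qed.

Lemma dvdz_expn_sub X u s :
  (k%:Z %| X * u%:Z - X)%Z -> (k%:Z %| X * (u ^ s)%N%:Z - X)%Z.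
Proof.
have E (v : int) : X * v - X = X * (v - 1) by ring.
by rewrite !E -[(u ^ s)%N%:Z]natz natrX natz subrX1 mulrA => /dvdz_mulr ->.
Qed.

(** Since n^q = 1 and q does not divide J, n is a power of n^J modulo k. So J may be replaced by 1,
    and the condition reads k | X (n - 1). *)
Lemma expgz_a_central X J : ~~ (q %| J)%N ->
  (k%:Z %| X * (n ^ J)%N%:Z - X)%Z = ((k %/ gcdn (n - 1) k)%N%:Z %| X)%Z.
Proof.
move=> qJ; transitivity (k%:Z %| X * n%:Z - X)%Z.
  apply/idP/idP => [|/dvdz_expn_sub->//].
  have [s eJs] := inv_mod_q qJ.
  move/(dvdz_expn_sub s); rewrite -expnM => kX.
  suff : (k%:Z %| X * (n ^ (J * s))%N%:Z - X * n%:Z)%Z.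
    move=> kX'; set w := X * (n ^ (J * s))%N%:Z in kX kX'.
    have -> : X * n%:Z - X = (w - X) - (w - X * n%:Z) by ring.
    exact: rpredB.
  rewrite -mulrBr dvdz_mull // dvdz_subn (divn_eq (J * s) q) eJs (modn_small q_gt1) expnD -modnMml.
  by rewrite expn_mod_order ?dvdn_mull // modnMml mul1n expn1.
set c := gcdn _ _.
have c_gt0 : (0 < c)%N by rewrite gcdn_gt0 k_gt0 orbT.
have [n' en] := dvdnP (dvdn_gcdl (n - 1) k); have [k' ek] := dvdnP (dvdn_gcdr (n - 1) k).
rewrite -/c in en ek.
have cnk : coprime k' n'.
  by rewrite /coprime gcdnC -(eqn_pmul2r c_gt0) mul1n muln_gcdl -en -ek.
have c0 : c%:Z != 0 by rewrite eqz_nat -lt0n.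
have -> : X * n%:Z - X = X * (n' * c)%N%:Z by rewrite -en -subzn //; ring.
rewrite ek mulnK // !PoszM mulrA (@dvdz_mul2r c%:Z _ _ c0).
by rewrite mulrC Gauss_dvdzr.
Qed.

(** The centralizer meets N in the centre, of order c l, and together with N it covers the group, as
    the powers of t represent all cosets of N. *)
Lemma card_cent_ab i J : ~~ (q %| J)%N ->
  #|'C[(A i * b ^+ J)%g]%g| = (gcdn (n - 1) k * (q * l))%N.
Proof.
move=> qJ; set c := gcdn _ _; set t := (_ * _)%g.
have ck : (c %| k)%N by apply: dvdn_gcdr.
have kck : (k %/ c %| k)%N by apply: dvdn_div.
have c_gt0 : (0 < c)%N by rewrite gcdn_gt0 k_gt0 orbT.
have centI : ('C[t] :&: ab_sub 1 = ab_sub (k %/ c))%g.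
  apply/setP => y; have [X [f ->]] := ab_repr y.
  rewrite in_setI !mem_ab_sub ?dvd1n // dvd1z /=.
  rewrite andbC; case: (boolP (q %| f)%N) => qf; rewrite ?andbF //= andbT.
  rewrite cent1E !mul_ab eq_ab [(f + J)%N]addnC eqxx andbT.
  rewrite -(expgz_a_central _ qJ).
  have kf : (k%:Z %| i * (n ^ f)%N%:Z - i)%Z.
    have -> : i * (n ^ f)%N%:Z - i = i * ((n ^ f)%N%:Z - 1%N%:Z) by ring.
    by rewrite dvdz_mull // dvdz_subn expn_mod_order.
  set u := X + _ - _.
  have -> : u = (i * (n ^ f)%N%:Z - i) - (X * (n ^ J)%N%:Z - X) by rewrite /u; ring.
  by rewrite rpredBl.
have centM : ('C[t] * ab_sub 1 = [set: gT])%g.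
  apply/eqP; rewrite eqEsubset subsetT; apply/subsetP => y _.
  have [X [f ->]] := ab_repr y.
  have [s eJs] := inv_mod_q qJ.
  (* Modulo q, J s = 1, so the exponent of b becomes (q - 1) f + f = q f = 0. *)
  have : (t ^+ (s * (q.-1 * f)) * (A X * b ^+ f) \in ab_sub 1)%g.
    rewrite pow_ab mul_ab mem_ab_sub ?dvd1n // dvd1z /=.
    rewrite mulnA /dvdn -modnDml -modnMml eJs modnMml mul1n modnDml.
    by rewrite -mulSnr prednK // modnMr.
  set ts := (t ^+ _)%g => tsy; rewrite -(mulKg ts (_ * _)%g) mem_mulg //.
  by rewrite groupV groupX // cent1id.
have := mul_cardG 'C[t]%g (ab_sub 1).
rewrite centM centI cardsT !card_ab_sub ?dvd1n // divn1 divnA // mulKn //.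
case: orders_semidirect => _ _ _ -> /eqP.
rewrite -[RHS]/(_ * _)%N.
have kl_gt0 : (0 < k * l)%N by rewrite muln_gt0 k_gt0.
have -> : (k * (q * l) * (c * l) = c * (q * l) * (k * l))%N by lia.
by rewrite eqn_pmul2r // => /eqP.
Qed.

(** * The equation (t y)^m = y^m as a congruence modulo k *)

Section TwistedPowers.
Variables (i : int) (J m' : nat).
Hypotheses (qJ : ~~ (q %| J)%N) (qlJ : (q * l %| q * m' * J)%N).

Let t := (A i * b ^+ J)%g.
Let D : int := m'%:Z * d%:Z.
Let E : int := m'%:Z * (d%:Z - q%:Z).

Lemma eq_twisted_exponent f : ((J + f) * (q * m') == f * (q * m') %[mod q * l])%N.
Proof. by rewrite mulnDl eqn_mod_dvd ?leq_addl // addnK [(J * _)%N]mulnC. Qed.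

Lemma pow_ab_ndvd_D X f : ~~ (q %| f)%N ->
  ((A X * b ^+ f) ^+ (q * m') = A (X * D)%R * b ^+ (f * (q * m')))%g.
Proof. by move=> qf; rewrite pow_ab_ndvd //; congr (A _ * _)%g; rewrite /D; ring. Qed.

Lemma twisted_ab_ndvd X f : ~~ (q %| J + f)%N ->
  ((t * (A X * b ^+ f)) ^+ (q * m') = A ((i + X) * D)%R * b ^+ ((J + f) * (q * m')))%g.
Proof.
move=> qf; rewrite mul_ab pow_ab_ndvd_D //; congr (_ * _)%g.
have -> : (i + X * (n ^ J)%N%:Z) * D = i * D + (X * m'%:Z) * d%:Z * (n ^ J)%N%:Z.
  by rewrite /D; ring.
by rewrite mulrDl !expgzD cyc_sum_shift /D !mulrA.
Qed.

(** Both m-th powers have exponent a multiple of D, and the contributions of X cancel. *)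
Lemma twisted_eq_ndvd X f : ~~ (q %| f)%N -> ~~ (q %| J + f)%N ->
  ((t * (A X * b ^+ f)) ^+ (q * m') == (A X * b ^+ f) ^+ (q * m'))%g = (k%:Z %| i * D)%Z.
Proof.
move=> qf qJf; rewrite twisted_ab_ndvd // pow_ab_ndvd_D // eq_ab eq_twisted_exponent andbT.
by congr (_ %| _)%Z; ring.
Qed.

(** Only t y lies outside N: the exponents of a are (i + X) D and X m, with m = D - E. *)
Lemma twisted_eq_dvd X f : (q %| f)%N ->
  ((t * (A X * b ^+ f)) ^+ (q * m') == (A X * b ^+ f) ^+ (q * m'))%g =
  (k%:Z %| i * D + X * E)%Z.
Proof.
move=> qf; rewrite twisted_ab_ndvd ?dvdn_addl // pow_ab_dvd // eq_ab.
rewrite eq_twisted_exponent andbT.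
by congr (_ %| _)%Z; rewrite /D /E PoszM; ring.
Qed.

End TwistedPowers.

Lemma twisted_eq_order i J m y :
  ((A i * b ^+ J * y) ^+ m == y ^+ m)%g -> (q * l %| m * J)%N.
Proof.
have [X [f ->]] := ab_repr y; rewrite mul_ab !pow_ab eq_ab => /andP[_].
by rewrite mulnDl eqn_mod_dvd ?leq_addl // addnK [(J * _)%N]mulnC.
Qed.

Lemma dvdz_cyc_sum : ((k %/ gcdn (n - 1) k)%N%:Z %| d%:Z)%Z.
Proof.
have q1 : ~~ (q %| 1)%N by rewrite dvdn1 gtn_eqF.
rewrite -(expgz_a_central _ q1) -oa -expgz_eq1 expgzD expgzN -[X in (X * _)%g](_ : A d%:Z = _).
  by rewrite mulgV.
by have := cyc_sum_shift 1 1; rewrite mul1r.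
Qed.

(** * Summing a linear character of the centre over the solutions *)

Section CharacterSum.
Variables (C : numClosedFieldType) (lam : gT -> C) (r s : int).
Local Notation c := (gcdn (n - 1) k).
Local Notation Z := (ab_sub (k %/ c)).
Hypothesis lam1 : lam 1%g = 1.
Hypothesis lamM : {in Z &, {morph lam : x y / (x * y)%g >-> x * y}}.
Hypothesis lam_a : forall X, ((k %/ c)%N%:Z %| X)%Z -> (lam (A X) == 1) = (k%:Z %| X * r)%Z.
Hypothesis lam_b : forall f : nat, (lam (b ^+ (q * f))%g == 1) = (l%:Z %| f%:Z * s)%Z.

Let kc_k : (k %/ c %| k)%N. Proof. by rewrite dvdn_div // dvdn_gcdr. Qed.

Lemma lam_mulV x : x \in Z -> lam x * lam x^-1%g = 1.
Proof. by move=> Zx; rewrite -lamM ?groupV // mulgV. Qed.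

Lemma lamV x : x \in Z -> lam x^-1%g = (lam x)^-1.
Proof.
move=> Zx; have := lam_mulV Zx; case: (eqVneq (lam x) 0) => [->|nz /(canRL (mulKf nz)) ->].
  by move/eqP; rewrite mul0r eq_sym oner_eq0.
by rewrite mulr1.
Qed.

Lemma lam_neq0 x : x \in Z -> lam x != 0.
Proof.
move=> /lam_mulV; case: eqP => // -> /eqP.
by rewrite mul0r eq_sym oner_eq0.
Qed.

Lemma mem_ab_center X f :
  ((k %/ c)%N%:Z %| X)%Z -> (q %| f)%N -> (A X * b ^+ f)%g \in Z.
Proof. by move=> kX qf; rewrite mem_ab_sub // kX. Qed.

Lemma mem_a_center X : ((k %/ c)%N%:Z %| X)%Z -> A X \in Z.
Proof. by move=> kX; rewrite -[A X]mulg1 -(expg0 b) mem_ab_center // dvdn0. Qed.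

Lemma mem_b_center f : (q %| f)%N -> (b ^+ f)%g \in Z.
Proof. by move=> qf; rewrite -[(b ^+ f)%g]mul1g (mem_ab_center (X := 0)) // dvdz0. Qed.

Section Twisted.
Variables (i : int) (J m' : nat) (u : int).
Hypotheses (qJ : ~~ (q %| J)%N) (qlJ : (q * l %| q * m' * J)%N).

Let m := (q * m')%N.
Let t := (A i * b ^+ J)%g.
Let D : int := m'%:Z * d%:Z.
Let E : int := m'%:Z * (d%:Z - q%:Z).
Let T y := ((t * y) ^+ m == y ^+ m)%g.
Let h := gcdn `|E| k.
Hypotheses (cuk : coprimez u k%:Z) (uE : (u * E = h%:Z %[mod k%:Z])%Z).
Let v := (m%:Z * i %/ h%:Z)%Z * u.
Let K := (k %/ h)%N.

Let hk : (h %| k)%N. Proof. exact: dvdn_gcdr. Qed.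
Let hE : (h%:Z %| E)%Z. Proof. exact: (dvdz_gcdl E k%:Z). Qed.
Let h_gt0 : (0 < h)%N. Proof. by rewrite gcdn_gt0 k_gt0 orbT. Qed.
Let Kh : k%:Z = K%:Z * h%:Z. Proof. by rewrite -PoszM divnK. Qed.
Let KcD X : ((k %/ c)%N%:Z %| X * D)%Z.
Proof. by rewrite dvdz_mull // dvdz_mull // dvdz_cyc_sum. Qed.
Let mE : m%:Z = D - E. Proof. by rewrite /m /D /E PoszM; ring. Qed.

Lemma mem_ab_sub1 X f : ((A X * b ^+ f)%g \in ab_sub 1) = (q %| f)%N.
Proof. by rewrite mem_ab_sub ?dvd1n // dvd1z. Qed.

(** For a solution, y^m may be read off from (t y)^m; the exponent becomes a multiple of D, so y^m
    is central. *)
Lemma twisted_pow_dvd X f : (q %| f)%N -> T (A X * b ^+ f)%g ->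
  ((A X * b ^+ f) ^+ m)%g = (A ((i + X) * D)%R * b ^+ (f * m))%g.
Proof.
move=> qf; rewrite /T twisted_eq_dvd // -/D -/E => kT.
rewrite pow_ab_dvd //; congr (_ * _)%g; apply: expgz_a_eq; rewrite mE -rpredN.
by move: kT; congr (_ %| _)%Z; ring.
Qed.

Lemma twisted_pow_center y : T y -> (y ^+ m)%g \in Z.
Proof.
have [X [f ->]] := ab_repr y; have [qf Ty | qf _] := boolP (q %| f)%N.
  by rewrite twisted_pow_dvd // mem_ab_center // dvdn_mulr.
by rewrite pow_ab_ndvd_D // mem_ab_center // /m mulnCA dvdn_mulr.
Qed.

(** Translation by the central b^q preserves the solutions and multiplies y^m by b^(q m), on which
    [lam] is not 1. *)
Lemma twisted_sum_eq0 : ~~ (l%:Z %| m%:Z * s)%Z -> \sum_(y | T y) lam (y ^- m)%g = 0.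
Proof.
move=> lms; have bqC y : commute (b ^+ q)%g y by apply/commute_sym/bq_central.
have bqX y : ((b ^+ q * y) ^+ m = b ^+ (q * m) * y ^+ m)%g by rewrite expgMn // -expgM.
apply: (@sum_shift_eq0 _ _ _ _ (b ^+ q)%g (lam (b ^+ (q * m))^-1%g)) => [y|y Ty|].
- rewrite /T mulgA -[(t * b ^+ q)%g]bqC -mulgA !bqX.
  by rewrite (inj_eq (mulgI _)).
- rewrite bqX invMg lamM ?groupV ?twisted_pow_center // 1?mulrC //.
  by rewrite mem_b_center ?dvdn_mulr.
by rewrite lamV ?mem_b_center ?dvdn_mulr // invr_eq1 lam_b.
Qed.

Hypothesis lms : (l%:Z %| m%:Z * s)%Z.

(* As q is prime to J, both q m' s and J m' s being multiples of l forces     *)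
(* m' s to be one, so that the case "l | m s but not l q | m s" never occurs. *)
Lemma dvdz_expn_phi : (l%:Z %| m'%:Z * s)%Z.
Proof.
have [e eJ] := inv_mod_q qJ.
have lJ : (l%:Z %| m'%:Z * J%:Z)%Z.
  by move: qlJ; rewrite -mulnA dvdn_pmul2l.
have Je : J%:Z * e%:Z = (J * e %/ q)%N%:Z * q%:Z + 1.
  by rewrite -!PoszM {1}(divn_eq (J * e) q) eJ modn_small.
have -> : m'%:Z * s = m'%:Z * J%:Z * (e%:Z * s) - m%:Z * s * (J * e %/ q)%N%:Z.
  have -> : m'%:Z * J%:Z * (e%:Z * s) = m'%:Z * s * (J%:Z * e%:Z) by ring.
  by rewrite Je /m PoszM; ring.
by rewrite rpredB // dvdz_mulr.
Qed.

Lemma lam_twisted X f :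
  ((k %/ c)%N%:Z %| X)%Z -> lam (A X * b ^+ (f * m))%g = lam (A X).
Proof.
move=> kX; rewrite lamM ?mem_a_center ?mem_b_center //; last by rewrite /m mulnCA dvdn_mulr.
rewrite [X in _ * X](_ : _ = 1) ?mulr1 //; apply/eqP.
by rewrite /m mulnCA lam_b PoszM -mulrA dvdz_mull // dvdz_expn_phi.
Qed.

Let inner y := (y \in ab_sub 1) && T y.

Lemma inner_ab X f : inner (A X * b ^+ f)%g = (q %| f)%N && (k%:Z %| i * D + X * E)%Z.
Proof. by rewrite /inner mem_ab_sub1; case: (boolP (q %| f)%N) => //= qf; rewrite /T twisted_eq_dvd. Qed.

(** A solution forces h | i D, and i D = m i modulo h because h | E. *)
Lemma inner_empty y : ~~ (h%:Z %| m%:Z * i)%Z -> inner y = false.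
Proof.
have [X [f ->]] := ab_repr y; rewrite inner_ab; apply: contraNF => /andP[_ kT].
have hT : (h%:Z %| i * D + X * E)%Z by apply: dvdz_trans kT; rewrite dvdzE.
have -> : m%:Z * i = (i * D + X * E) - (i + X) * E by rewrite mE; ring.
by rewrite rpredB // dvdz_mull.
Qed.

(** Multiplied by the unit u, i D + X E becomes (v + i + X) h modulo k. *)
Lemma inner_coset y : (h%:Z %| m%:Z * i)%Z -> inner y = ((A (v + i)%R * y)%g \in ab_sub K).
Proof.
move=> hmi; have [X [f ->]] := ab_repr y.
rewrite mulgA -expgzD inner_ab mem_ab_sub ?dvdn_div // andbC; congr (_ && _).
have vh : v * h%:Z = m%:Z * i * u by rewrite /v mulrAC divzK.
have /dvdzP[w ew] : (k%:Z %| u * E - h%:Z)%Z by rewrite -eqz_mod_dvd uE.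
have cku : coprimez k%:Z u by rewrite coprimez_sym.
rewrite -(Gauss_dvdzr _ cku).
have -> : u * (i * D + X * E) = (v + i + X) * h%:Z + (i + X) * w * k%:Z.
  have -> : (v + i + X) * h%:Z = v * h%:Z + (i + X) * h%:Z by ring.
  have -> : (i + X) * w * k%:Z = (i + X) * (u * E - h%:Z) by rewrite ew; ring.
  by rewrite vh mE; ring.
rewrite rpredDr; last by rewrite dvdz_mull.
by rewrite Kh dvdz_mul2r // eqz_nat -lt0n.
Qed.

Lemma card_inner : (h%:Z %| m%:Z * i)%Z -> #|inner| = (h * l)%N.
Proof.
move=> hmi; have kKh : (k %/ K = h)%N by rewrite /K divnA // mulKn.
rewrite -kKh -card_ab_sub ?dvdn_div // -(card_imset (mem (ab_sub K)) (mulgI (A (v + i))^-1%g)).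
apply: eq_card => y; apply/idP/imsetP => [|[w Kw ->]].
  rewrite -[y \in _]/(inner y) inner_coset // => Ky; exists (A (v + i)%R * y)%g => //.
  by rewrite mulKg.
by rewrite -[_ \in _]/(inner _) inner_coset // mulKVg.
Qed.

Let xi := lam (A (v * D)).

(** This decides whether [lam] is 1 at a^(K D), the factor that y^m acquires when y in N is
    translated by a^K. *)
Lemma dvdz_KD : (k%:Z %| K%:Z * D * r)%Z = (h%:Z %| m%:Z * r)%Z.
Proof.
rewrite Kh -mulrA dvdz_mul2l; last by rewrite eqz_nat -lt0n divn_gt0 // dvdn_leq.
have -> : D * r = m%:Z * r + E * r by rewrite mE; ring.
by rewrite rpredDr // dvdz_mulr.
Qed.

Lemma inner_lam y : (h%:Z %| m%:Z * i)%Z -> (h%:Z %| m%:Z * r)%Z -> inner y ->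
  lam (y ^+ m)%g = xi^-1.
Proof.
move=> hmi hmr inner_y; have := inner_y; rewrite inner_coset //; move: inner_y.
have [X [f ->]] := ab_repr y; rewrite mulgA -expgzD mem_ab_sub ?dvdn_div //.
case/andP; rewrite mem_ab_sub1 => qf Ty /andP[/dvdzP[z ez] _].
rewrite twisted_pow_dvd // lam_twisted // -lamV ?mem_a_center // -expgzN.
have -> : (i + X) * D = - (v * D) + z * K%:Z * D by rewrite -ez; ring.
rewrite expgzD lamM ?mem_a_center ?rpredN //.
have /eqP-> : lam (A (z * K%:Z * D)) == 1.
  rewrite lam_a //; have -> : z * K%:Z * D * r = z * (K%:Z * D * r) by ring.
  by rewrite dvdz_mull // dvdz_KD.
by rewrite mulr1.
Qed.

(** The boolean selects the inverse values, for the solutions in N, or the values themselves, for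
    those with t y in N after [translate_sum]. *)
Lemma inner_sum_eq0 (e : bool) : ~~ ((h%:Z %| m%:Z * i)%Z && (h%:Z %| m%:Z * r)%Z) ->
  \sum_(y | inner y) (if e then (lam (y ^+ m)%g)^-1 else lam (y ^+ m)%g) = 0.
Proof.
have [hmi /= hmr | hmi _] := boolP (h%:Z %| m%:Z * i)%Z; last first.
  by rewrite big_pred0 // => y; rewrite inner_empty.
pose z := lam (A (K%:Z * D)).
have z1 : z != 1 by rewrite lam_a // dvdz_KD.
apply: (@sum_shift_eq0 _ _ _ _ (A K) (if e then z^-1 else z)) => [y|y inner_y|].
- rewrite !inner_coset // mulgA -expgzD [v + i + _]addrC expgzD -mulgA [LHS]groupMl //.
  by rewrite -[A K]mulg1 -(expg0 b) mem_ab_sub ?dvdn_div // dvdzz dvdn0.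
- have -> : lam ((A K * y) ^+ m)%g = z * lam (y ^+ m)%g.
    move: inner_y; have [X [f ->]] := ab_repr y => /andP[]; rewrite mem_ab_sub1 => qf Ty.
    rewrite mulgA -expgzD (pow_ab_dvd (K%:Z + X)) // mulrDl expgzD -mulgA -(pow_ab_dvd X) //.
    have -> : A (K%:Z * m) = A (K%:Z * D).
      apply: expgz_a_eq; rewrite mE -mulrBr.
      have -> : D - E - D = - E by ring.
      by rewrite mulrN rpredN Kh dvdz_mul.
    by rewrite lamM ?twisted_pow_center // mem_a_center.
  by case: (e) => //; rewrite invfM.
by case: (e); rewrite ?invr_eq1.
Qed.

Lemma xi_sqr : (h%:Z %| m%:Z * i)%Z -> (h%:Z %| m%:Z * r)%Z -> xi * xi = 1.
Proof.
move=> hmi hmr; rewrite /xi -lamM ?mem_a_center // -expgzD; apply/eqP.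
rewrite lam_a ?rpredD //.
have -> : (v * D + v * D) * r = 2%:Z * ((q%:Z * m'%:Z * i %/ h%:Z)%Z * u * D) * r.
  by rewrite /v /m PoszM; ring.
by apply: (dvdz_double_exponent k_gt1 q_pr n_gt0 nq1); rewrite -PoszM.
Qed.

Lemma inner_sum (e : bool) :
  \sum_(y | inner y) (if e then (lam (y ^+ m)%g)^-1 else lam (y ^+ m)%g) =
  if (h%:Z %| m%:Z * i)%Z && (h%:Z %| m%:Z * r)%Z then (h * l)%:R * xi else 0.
Proof.
case: ifPn => [/andP[hmi hmr] | /inner_sum_eq0-> //].
have xi0 : xi != 0 by rewrite lam_neq0 ?mem_a_center.
have xiV : xi^-1 = xi by apply: (mulfI xi0); rewrite mulfV // xi_sqr.
rewrite (eq_bigr (fun=> xi)) => [|y inner_y].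
  by rewrite sumr_const card_inner // mulr_natl.
by rewrite inner_lam // invrK xiV; case: (e).
Qed.

Let inN y := y \in ab_sub 1.
Let intN y := (t * y)%g \in ab_sub 1.
Let outer y := ~~ inN y && ~~ intN y.

Lemma t_notin : t \notin ab_sub 1. Proof. by rewrite mem_ab_sub1. Qed.

Lemma outer_ab X f : outer (A X * b ^+ f)%g = ~~ (q %| f)%N && ~~ (q %| J + f)%N.
Proof. by rewrite /outer /inN /intN mul_ab !mem_ab_sub1. Qed.

Lemma translate_notin y : intN y -> ~~ inN y.
Proof.
by move=> Nty; apply: contra t_notin => Ny; move: Nty; rewrite /intN groupMr.
Qed.

Lemma card_translate : #|intN| = (k * l)%N.
Proof.
rewrite -[(k * l)%N]/(k * l)%N -[k in RHS]divn1 -card_ab_sub ?dvd1n //.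
rewrite -(card_imset (mem (ab_sub 1)) (mulgI t^-1%g)).
apply: eq_card => y; apply/idP/imsetP => [Nty | [w Nw ->]].
  by exists (t * y)%g => //; rewrite mulKg.
by rewrite -[_ \in _]/(intN _) /intN mulKVg.
Qed.

(** N and t^-1 N are disjoint, each of order k l. The count is made in [C], where q - 2 is a true
    difference. *)
Lemma card_outer : #|outer|%:R = (k * l)%:R * (q%:R - 2%:R) :> C.
Proof.
have : (#|gT| = k * l + (k * l + #|outer|))%N.
  rewrite -sum1_card (bigID inN) /= sum1_card -{1}[k]divn1 -card_ab_sub ?dvd1n //.
  congr (_ + _)%N; rewrite (bigID intN) /= !sum1_card -card_translate; congr (_ + _)%N.
  by apply: eq_card => y; apply: (andb_idl (@translate_notin y)).
case: orders_semidirect => _ _ _ -> /(congr1 (fun x => x%:R : C)).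
by rewrite !natrD !natrM => e; apply/eqP; rewrite -subr_eq0; apply/eqP; ring: e.
Qed.

(** Translation by a multiplies y^m by a^D here, so the sum vanishes unless [lam] is 1 at a^D; in
    that case every term is 1. *)
Lemma outer_sum :
  \sum_(y | T y && outer y) lam (y ^- m)%g =
  if (k%:Z %| i * D)%Z && (k%:Z %| D * r)%Z then (k * l)%:R * (q%:R - 2%:R) else 0.
Proof.
have outer_T y : outer y -> T y = (k%:Z %| i * D)%Z.
  have [X [f ->]] := ab_repr y; rewrite outer_ab => /andP[qf qJf].
  exact: twisted_eq_ndvd.
have [kiD | kiD] /= := boolP (k%:Z %| i * D)%Z; last first.
  by rewrite big_pred0 // => y; apply/negP=> /andP[Ty /outer_T]; rewrite Ty (negPf kiD).
rewrite (eq_bigl outer) => [|y]; last first.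
  by rewrite andbC; case: (boolP (outer y)) => //= /outer_T->.
have lam_outer X f : ~~ (q %| f)%N ->
    lam ((A X * b ^+ f) ^- m)%g = (lam (A (X * D)))^-1.
  move=> qf; rewrite pow_ab_ndvd_D // lamV; first by rewrite lam_twisted.
  by rewrite mem_ab_center // /m mulnCA dvdn_mulr.
case: ifP => kDr.
  rewrite -card_outer -sumr_const; apply: eq_bigr => y.
  have [X [f ->]] := ab_repr y; rewrite outer_ab => /andP[qf _].
  rewrite lam_outer //; apply/eqP; rewrite invr_eq1 lam_a //.
  by rewrite -mulrA dvdz_mull.
apply: (@sum_shift_eq0 _ _ _ _ (A 1) (lam (A D))^-1) => [y|y|].
- by have [X [f ->]] := ab_repr y; rewrite mulgA -expgzD !outer_ab.
- have [X [f ->]] := ab_repr y; rewrite outer_ab => /andP[qf _].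
  rewrite mulgA -expgzD !lam_outer // mulrDl mul1r expgzD lamM ?invfM //; apply: mem_a_center => //.
  by have := KcD 1; rewrite mul1r.
by rewrite invr_eq1 lam_a ?kDr //; have := KcD 1; rewrite mul1r.
Qed.

(* The substitution y := (y t)^-1 preserves T and replaces y^-m by y^m. *)
Lemma translate_sum :
  \sum_(y | T y && (~~ inN y && intN y)) lam (y ^- m)%g =
  \sum_(y | inner y) lam (y ^+ m)%g.
Proof.
have T_conj y : ((y * t) ^+ m == y ^+ m)%g = T y.
  rewrite /T -[LHS](inj_eq (conjg_inj y)) !conjXg; congr (_ ^+ _ == _ ^+ _)%g.
    by rewrite conjgE -mulgA mulKg.
  by rewrite conjgE mulKg.
have inj_h : injective (fun y => (y * t)^-1%g) by move=> x y /invg_inj/mulIg.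
rewrite (reindex_inj inj_h); apply: eq_big => y.
  rewrite (andb_idl (@translate_notin _)).
  rewrite /intN /inner invMg mulKVg groupV andbC; congr (_ && _).
  by rewrite -[RHS]T_conj /T mulKVg -invMg !expgVn (inj_eq invg_inj) eq_sym.
rewrite (andb_idl (@translate_notin _)).
case/andP; rewrite {1}/T invMg mulKVg -invMg => /eqP <- _.
by rewrite expgVn invgK.
Qed.

Lemma twisted_sum :
  \sum_(y | T y) lam (y ^- m)%g =
  l%:R * ((if (k%:Z %| i * D)%Z && (k%:Z %| D * r)%Z then k%:R * (q%:R - 2%:R) else 0) +
   (if (h%:Z %| m%:Z * i)%Z && (h%:Z %| m%:Z * r)%Z then 2%:R * xi * h%:R else 0)).
Proof.
rewrite (bigID inN) [X in _ + X = _](bigID intN) /=.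
rewrite (eq_bigl inner) => [|y]; last by rewrite andbC.
rewrite (eq_bigr (fun y => (lam (y ^+ m)%g)^-1)) => [|y /andP[_ Ty]]; last first.
  by rewrite lamV // twisted_pow_center.
rewrite (inner_sum true).
under [X in _ + (X + _)]eq_bigl do rewrite -andbA.
under [X in _ + (_ + X)]eq_bigl do rewrite -andbA.
rewrite translate_sum (inner_sum false) outer_sum !natrM.
by case: ifP => _; case: ifP => _; ring.
Qed.

End Twisted.
End CharacterSum.

(** * Values of the trace on the centre *)

Section CentralTrace.
Variables (C : numClosedFieldType).
Variables (lam psi phi : gT -> C) (r s : int) (K : nat).
Hypotheses (psi_gen : generates_dual <[a ^+ K]>%g psi).
Hypotheses (phi_gen : generates_dual <[b ^+ q]>%g phi).
Hypothesis lam_psi_phi : {in <[a ^+ K]>%g & <[b ^+ q]>%g,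
  forall x y, lam (x * y)%g = psi x ^ r * phi y ^ s}.

Let psi1 : psi 1%g = 1. Proof. by case: psi_gen => -[]. Qed.
Let phi1 : phi 1%g = 1. Proof. by case: phi_gen => -[]. Qed.

Lemma central_trace_a x : x \in <[a ^+ K]>%g -> lam x = psi x ^ r.
Proof. by move=> Kx; rewrite -[x in lam x]mulg1 lam_psi_phi ?group1 // phi1 exp1rz mulr1. Qed.

Lemma central_trace_b y : y \in <[b ^+ q]>%g -> lam y = phi y ^ s.
Proof. by move=> qy; rewrite -[y in lam y]mul1g lam_psi_phi ?group1 // psi1 exp1rz mul1r. Qed.

Lemma central_trace1 : lam 1%g = 1.
Proof. by rewrite central_trace_a ?group1 // psi1 exp1rz. Qed.

Lemma central_traceM : {in ab_sub K &, {morph lam : x y / (x * y)%g >-> x * y}}.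
Proof.
move=> x y; have EK := ab_subE K.
rewrite -[x \in _]/(x \in (ab_sub K : {set gT})) -[y \in _]/(y \in (ab_sub K : {set gT})).
rewrite EK => /mulsgP[x1 x2 Kx1 qx2 ->] /mulsgP[y1 y2 Ky1 qy2 ->].
have cx2 : commute x2 y1.
  by case/cycleP: qx2 => e ->; apply/commute_sym/commuteX/bq_central.
have -> : (x1 * x2 * (y1 * y2) = (x1 * y1) * (x2 * y2))%g.
  by rewrite -!mulgA [(x2 * (y1 * _))%g]mulgA cx2 !mulgA.
rewrite !lam_psi_phi ?groupM //.
have [[_ psiM] _] := psi_gen; have [[_ phiM] _] := phi_gen.
by rewrite psiM // phiM // !expfzMl; ring.
Qed.

Lemma expgz_subcycle X : (K%:Z %| X)%Z -> A X \in <[a ^+ K]>%g.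
Proof.
case/dvdzP=> Y ->; rewrite mulrC expgzMz; exact: mem_expgz.
Qed.

Lemma central_trace_expgz_a X : (K%:Z %| X)%Z -> lam (A X) = psi (A (X * r)).
Proof.
move=> KX; rewrite central_trace_a ?expgz_subcycle // expgzMz.
by rewrite (linear_char_expgz psi_gen.1 _ (expgz_subcycle KX)).
Qed.

(** The trace at a^X is [psi] at a^(X r), and [psi] is faithful. *)
Lemma central_trace_a_eq1 X : (K%:Z %| X)%Z -> (lam (A X) == 1) = (k%:Z %| X * r)%Z.
Proof.
move=> KX; rewrite central_trace_expgz_a //.
rewrite -oa -expgz_eq1; apply/eqP/eqP => [|->]; last exact: psi1.
by apply: (generates_dual_eq1 psi_gen); rewrite expgz_subcycle // dvdz_mulr.
Qed.

Lemma central_trace_b_eq1 (f : nat) : (lam (b ^+ (q * f))%g == 1) = (l%:Z %| f%:Z * s)%Z.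
Proof.
have qf : (b ^+ (q * f))%g \in <[b ^+ q]>%g by rewrite expgM mem_cycle.
rewrite central_trace_b // -(linear_char_expgz phi_gen.1 _ qf) //.
rewrite -[X in expgz X _]/(expgz b (q * f)%N%:Z) -expgzMz.
have -> : (l%:Z %| f%:Z * s)%Z = (#[b]%g%:Z %| (q * f)%N%:Z * s)%Z.
  by rewrite ob !PoszM -mulrA dvdz_mul2l // eqz_nat -lt0n prime_gt0.
rewrite -expgz_eq1; apply/eqP/eqP => [|->]; last exact: phi1.
apply: (generates_dual_eq1 phi_gen); rewrite expgzMz.
by apply: (subsetP _ _ (mem_expgz (b ^+ (q * f))%g s)); rewrite cycle_subG.
Qed.

End CentralTrace.

End Semidirect.

(** * Assembling the indicator formula *)

Theorem theorem4p9
  (C : numClosedFieldType) (gT : finGroupType) (k q l n : nat) (a b : gT)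
  (k_gt0 : (0 < k)%N) (l_gt0 : (0 < l)%N) (n_gt0 : (0 < n)%N)
  (q_pr : prime q) (q_dvd_Aut : (q %| #|Aut (Zp k)|)%N)
  (nq_eq1 : (n ^ q = 1 %[mod k])%N) (n_neq1 : (n <> 1 %[mod k])%N)
  (presG : presented_semidirect k (q * l) n a b)
  (i j : int) (q_ndvd_j : ~~ (q%:Z %| j)%Z)
  (dW : nat)
  (rho : mx_representation C 'C[(expgz a i * expgz b j)%g] dW)
  (irr_rho : mx_irreducible rho)
  (psi phi : gT -> C) (r s : int) (m : nat) (m_gt0 : (0 < m)%N)
  (g : class_type (expgz a i * expgz b j)%g -> gT) (g_reps : class_reps g) :
  let c : nat := gcdn (n - 1) k in
  let d : nat := (\sum_(0 <= h < q) n ^ h)%N in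
  let A : int := (m %/ q)%N%:Z * (d%:Z - q%:Z) in
  let h : int := gcdz A k%:Z in
  let nu : C := indicator g rho m in
  generates_dual <[a ^+ (k %/ c)]>%g psi ->
  generates_dual <[b ^+ q]>%g phi ->
  {in <[a ^+ (k %/ c)]>%g & <[b ^+ q]>%g,
    forall x y, \tr (rho (x * y)%g) = psi x ^ r * phi y ^ s} ->
  (~~ ((q * l)%N%:Z %| m%:Z * j)%Z -> nu = 0)
  /\
  (forall u : int, coprimez u k%:Z -> (u * A = h %[mod k%:Z])%Z ->
   let v : int := (m%:Z * i %/ h)%Z * u in
   let xi : C := psi (expgz a (r * d%:Z * (m %/ q)%N%:Z * v)) in
   let kq_dvd : bool := ((k * q)%N%:Z %| m%:Z * d%:Z * i)%Z &&
                        ((k * q)%N%:Z %| m%:Z * d%:Z * r)%Z in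
   let h_dvd : bool := (h %| m%:Z * i)%Z && (h %| m%:Z * r)%Z in
   let l_dvd : bool := (l%:Z %| m%:Z * s)%Z in
   let lq_dvd : bool := ((l * q)%N%:Z %| m%:Z * s)%Z in
   let val1 : C := (k%:R * (q%:R - 2%:R) + 2%:R * xi * h%:~R) / (c * q)%:R in
   let val2 : C := 2%:R * h%:~R / (c * q)%:R * xi in
   let val3 : C := 2%:R / (c * q)%:R * (xi * h%:~R - k%:R) in
   (~~ (q %| l)%N -> ((q * l)%N%:Z %| m%:Z * j)%Z ->
    nu = if kq_dvd && l_dvd then val1
         else if [&& h_dvd, l_dvd & ~~ kq_dvd] then val2
         else 0)
   /\
   ((q %| l)%N -> ((q * l)%N%:Z %| m%:Z * j)%Z ->
    nu = if kq_dvd && lq_dvd then val1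
         else if [&& h_dvd, l_dvd & ~~ kq_dvd] then val2
         else if [&& kq_dvd, l_dvd & ~~ lq_dvd] then val3
         else 0)).
Proof.
move=> c d A h nu psi_gen phi_gen chi.
have k_gt1 : (1 < k)%N.
  by rewrite ltn_neqAle k_gt0 andbT; apply: contra_not_neq n_neq1 => <-; rewrite !modn1.
have q_gt0 := prime_gt0 q_pr.
have N_gt0 : (0 < q * l)%N by rewrite muln_gt0 q_gt0.
have [_ ob _ _] := orders_semidirect k_gt1 q_pr l_gt0 nq_eq1 presG.
have [J [bJ ndvdJ dvdJ]] : exists J, [/\ expgz b j = (b ^+ J)%g, ~~ (q %| J)%N &
    ((q * l)%N%:Z %| m%:Z * j)%Z = (q * l %| m * J)%N].
  have N0 : (q * l)%N%:Z != 0 by rewrite eqz_nat -lt0n.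
  (* The natural representative of j modulo q l, the order of b. *)
  pose J := `|(j %% (q * l)%N%:Z)%Z|%N.
  have dvd_jJ : ((q * l)%N%:Z %| j - J%:Z)%Z.
    by rewrite (gez0_abs (modz_ge0 j N0)) -eqz_mod_dvd modz_mod.
  have jE : j = (j - J%:Z) + J%:Z by rewrite subrK.
  exists J; split; first by rewrite (expgz_mod _ N_gt0) // -ob expg_order.
    apply: contra q_ndvd_j => qJ; rewrite jE.
    by rewrite rpredD // (dvdz_trans _ dvd_jJ) // PoszM dvdz_mulr.
  by rewrite jE mulrDr rpredDl; [rewrite -PoszM | rewrite dvdz_mull].
pose lam (x : gT) := \tr (rho x).
have nuE : nu = (c * (q * l))%:R^-1 *
    \sum_(y | ((expgz a i * b ^+ J * y) ^+ m == y ^+ m)%g) lam (y ^- m)%g.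
  rewrite -(card_cent_ab k_gt1 q_pr l_gt0 nq_eq1 n_gt0 presG i ndvdJ) -bJ.
  exact: indicatorE.
have lam_chi : {in <[a ^+ (k %/ c)]>%g & <[b ^+ q]>%g,
    forall x y, lam (x * y)%g = psi x ^ r * phi y ^ s} by exact: chi.
have lam1 := central_trace1 psi_gen phi_gen lam_chi.
have lamM := central_traceM k_gt1 q_pr l_gt0 nq_eq1 n_gt0 presG psi_gen phi_gen lam_chi.
have lam_a := central_trace_a_eq1 k_gt1 q_pr l_gt0 nq_eq1 presG psi_gen phi_gen lam_chi.
have lam_b := central_trace_b_eq1 k_gt1 q_pr l_gt0 nq_eq1 presG psi_gen phi_gen lam_chi.
rewrite dvdJ; split=> [ndvd_mJ|u co_uk uA v xi kq_dvd h_dvd l_dvd lq_dvd val1 val2 val3].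
  rewrite nuE big_pred0 ?mulr0 // => y; apply: contraNF ndvd_mJ.
  exact: (twisted_eq_order k_gt1 q_pr l_gt0 nq_eq1 n_gt0 presG).
have q0 : q%:Z != 0 by rewrite eqz_nat -lt0n.
have dvdn_m : (q * l %| m * J)%N -> m = (q * (m %/ q))%N.
  move=> qlJ; have : (q %| m * J)%N := dvdn_trans (dvdn_mulr l (dvdnn q)) qlJ.
  by rewrite Euclid_dvdM // (negPf ndvdJ) orbF mulnC => /divnK.
suff nu_val : (q * l %| m * J)%N -> nu = if l_dvd then
    (if kq_dvd then val1 else if h_dvd then val2 else 0) else 0.
  (* Under ql | m j the conditions l | m s and lq | m s agree, so [val3] is never attained and (ii)
     and (iii) share one formula. *)
  have lq_l : (q * l %| m * J)%N -> l_dvd = lq_dvd.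
    move=> qlJ; have qm := dvdn_m qlJ; rewrite /lq_dvd.
    have -> : m%:Z * s = (m %/ q)%N%:Z * s * q%:Z by rewrite {1}qm PoszM; ring.
    rewrite PoszM dvdz_mul2r //; apply/idP/idP => [l_dvd1 | ldvd].
      by apply: (dvdz_expn_phi k_gt1 q_pr l_gt0 nq_eq1 n_gt0 presG ndvdJ); rewrite -qm.
    by rewrite /l_dvd {1}qm PoszM -mulrA dvdz_mull.
  split=> [_ qlJ|_ qlJ]; rewrite nu_val //; last rewrite -lq_l //.
    by case: (l_dvd); case: (kq_dvd); rewrite ?andbT ?andbF.
  by case: (l_dvd); case: (kq_dvd); rewrite ?andbT ?andbF.
move=> qlJ; pose m' := (m %/ q)%N; have qm : m = (q * m')%N := dvdn_m qlJ.
have mE : m%:Z = q%:Z * m'%:Z by rewrite qm PoszM.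
pose D := m'%:Z * d%:Z.
have mdE X : m%:Z * d%:Z * X = X * D * q%:Z by rewrite mE /D; ring.
have kqE : kq_dvd = (k%:Z %| i * D)%Z && (k%:Z %| D * r)%Z.
  by rewrite /kq_dvd !mdE PoszM !dvdz_mul2r // [r * D]mulrC.
have xiE : lam (expgz a (v * D)) = xi.
  rewrite (central_trace_expgz_a psi_gen phi_gen lam_chi) //.
    by congr (psi (expgz a _)); rewrite /D -/m'; ring.
  rewrite dvdz_mull // dvdz_mull //.
  exact: (dvdz_cyc_sum k_gt1 q_pr l_gt0 nq_eq1 n_gt0 presG).
have hk : (h %| k%:Z)%Z := dvdz_gcdr A k%:Z.
have hA : (h %| A)%Z := dvdz_gcdl A k%:Z.
have mDA : m%:Z = D - A by rewrite mE /A /D -/m'; ring.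
(* Since m = D - A and h divides both A and k, the first condition implies the second, so [val1]
   contains both terms. *)
have kq_h : kq_dvd -> h_dvd.
  rewrite kqE => /andP[kiD kDr]; rewrite /h_dvd mDA !mulrBl.
  rewrite !rpredB // ?(dvdz_mulr _ hA) // (dvdz_trans hk) //.
  by rewrite mulrC.
rewrite nuE qm.
have qlJ' : (q * l %| q * m' * J)%N by rewrite -qm.
have [l_dvd1|l_ndvd] := boolP l_dvd; last first.
  rewrite (twisted_sum_eq0 k_gt1 q_pr l_gt0 nq_eq1 n_gt0 presG lam1 lamM lam_b) ?mulr0 //.
  by rewrite -qm.
have l_dvd1' : (l%:Z %| (q * m')%N%:Z * s)%Z by rewrite -qm.
rewrite (twisted_sum k_gt1 q_pr l_gt0 nq_eq1 n_gt0 presG lam1 lamM lam_a lam_b i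
   ndvdJ qlJ' co_uk uA l_dvd1').
rewrite -qm -[LHS]/((c * (q * l))%:R^-1 * (l%:R *
  ((if (k%:Z %| i * D)%Z && (k%:Z %| D * r)%Z then k%:R * (q%:R - 2%:R) else 0) +
   (if h_dvd then 2%:R * lam (expgz a (v * D)) * h%:~R else 0)))).
have nat0 (x : nat) : (0 < x)%N -> x%:R != 0 :> C by rewrite Num.Theory.pnatr_eq0 -lt0n.
have c0 : c%:R != 0 :> C by rewrite nat0 // gcdn_gt0 k_gt0 orbT.
have [q_neq0 l_neq0] := (nat0 q q_gt0, nat0 l l_gt0).
rewrite -kqE xiE /val1 /val2 !natrM; clearbody xi.
have [kq1|_] := boolP kq_dvd; first by rewrite kq_h //; field; rewrite c0 q_neq0.
by case: (h_dvd); rewrite ?add0r ?mulr0 //; field; rewrite c0 q_neq0.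
Qed.
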